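(* Let $I=[0,T]$ be a bounded time interval. Let $\mathcal{B}$ be a separable, reflexive, uniformly smooth Banach space which is ''$I$-smoothly weakly compact'' for an exponent $p\in[2,\infty)$. Let $r>0$ be a fixed real and let $f:\mathcal{B}\to\mathcal{B}$ be a continuous function admitting at most a linear growth: there exists a constant $L>0$ such that $\|f(x)\|\le L(1+\|x\|)$ for all $x\in\mathcal{B}$. Let $a\in\mathcal{B}$ and let $C_0$ be a nonempty ball-compact subset of $\mathcal{B}$ which, for every $t\in I$, is $(r,\,f(\cdot+ta)-a)$-prox-regular. Consider the set-valued map $C(\cdot)$ defined by $C(t)=C_0+ta$ for all $t\in I$. Then for all $u_0\in C_0$, the system $$\dot u(t)+\mathrm{N}(C(t),u(t))\ni f(u(t))\ \text{ for a.e. } t\in I,\qquad u(0)=u_0,$$ has an absolutely continuous solution $u$, and for all $t\in I$, $u(t)\in C(t)$.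
   Context: Banach spaces are real; the norm of $\mathcal{B}$ is $\|\cdot\|$. Projection: for $C\subset\mathcal{B}$ closed and $x\in\mathcal{B}$, $P_C(x):=\{y\in C:\ \|x-y\|=d(x,C)\}$ (a possibly empty or multi-element set; when it is a singleton it is identified with its element). Proximal normal cone: for $x\in C$, $\mathrm{N}(C,x):=\{v\in\mathcal{B}:\ \exists s>0,\ x\in P_C(x+sv)\}$. For $x\in C$ and $r>0$, $\Gamma^r(C,x):=\{v\in\mathcal{B}:\ x\in P_C(x+rv)\}$. Directional prox-regularity: for a mapping $g:\mathcal{B}\to\mathcal{B}$, a closed set $C$ is $(r,g)$-prox-regular if for all $x\in C$ and all $s\in(0,r)$: (a) the projection $z:=P_C\left(x+s\frac{g(x)}{\|g(x)\|}\right)$ is well-defined (a single point); and (b) with $y:=x+s\frac{g(x)}{\|g(x)\|}$, one has $\frac{y-z}{\|y-z\|}\in\Gamma^r(C,z)$. By convention $\frac{v}{\|v\|}:=0$ if $v=0$. Here $f(\cdot+ta)-a$ denotes the map $x\mapsto f(x+ta)-a$. Ball-compact: $C\subset\mathcal{B}$ is ball-compact if for every closed ball $\overline{B}(x,R)$ the set $\overline{B}(x,R)\cap C$ is compact (in particular $C$ is closed). Uniformly smooth: a Banach space $E$ is uniformly smooth if $\lim_{t\to0}\frac{\|x_0+th\|_E-\|x_0\|_E}{t}$ exists uniformly with respect to unit vectors $x_0,h$. For uniformly smooth $E$ and $p\in(1,\infty)$, $x\mapsto\|x\|_E^p$ is $C^1$ on $E$ and $J_p(x):=\frac1p(\nabla\|\cdot\|_E^p)(x)\in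 E^*$. $I$-smoothly weakly compact: a separable reflexive uniformly smooth Banach space $E$ is $I$-smoothly weakly compact for an exponent $p\in(1,\infty)$ if from every bounded sequence $(x_n)_{n\ge0}$ of $L^\infty(I,E)$ one can extract a subsequence $(y_n)_{n\ge0}$ converging weakly to some $y\in L^\infty(I,E)$ (weak convergence in $L^\infty(I,E)=[L^1(I,E^* )]^*$, i.e. tested against $L^1(I,E^* )$) such that for all $z\in L^\infty(I,E)$ and $\phi\in L^1(I,\mathbb{R})$, $$\lim_{n\to\infty}\int_I\langle J_p(z(t)+y_n(t))-J_p(y_n(t)),y_n(t)\rangle\,\phi(t)\,dt=\int_I\langle J_p(z(t)+y(t))-J_p(y(t)),y(t)\rangle\,\phi(t)\,dt,$$ where $\langle\cdot,\cdot\rangle$ is the $E^*$–$E$ duality pairing. *)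

(* Defs.v *)
From HB Require Import structures.
From mathcomp Require Import all_boot all_order all_algebra.
From mathcomp Require Import all_classical all_reals all_analysis.

Set Implicit Arguments.
Unset Strict Implicit.
Unset Printing Implicit Defensive.

Import Order.TTheory GRing.Theory Num.Theory.
Import numFieldNormedType.Exports.

Local Open Scope classical_set_scope.
Local Open Scope ring_scope.

Section Dual.
Context {R : realType} {V : normedModType R}.

Definition continuous_form : {pred V -> R^o} :=
  fun l => `[< linear l /\ continuous l >].

Record dual := Dual {
  dual_fun :> V -> R^o;
  dual_funP : dual_fun \in continuous_form
}.

HB.instance Definition _ := [isSub for dual_fun].
HB.instance Definition _ := [Choice of dual by <:].

Lemma continuous_form_submod_closed : GRing.submod_closed continuous_form.
Proof.
split=> [|c l m].
  apply/asboolP; split; last by move=> x; exact: cvg_cst.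
  by move=> a x y; rewrite scaler0 addr0.
move=> /asboolP[linl cl] /asboolP[linm cm]; apply/asboolP; split.
  move=> a x y; rewrite /= !fctE linl linm !scalerDr !scalerA.
  by rewrite (mulrC c a) addrACA.
by move=> x; apply: cvgD; [apply: cvgZl_tmp; exact: cl|exact: cm].
Qed.

HB.instance Definition _ := GRing.isSubmodClosed.Build R (V -> R^o)
  continuous_form continuous_form_submod_closed.
HB.instance Definition _ := [SubChoice_isSubLmodule of dual by <:].

Definition dual_norm (l : dual) : R :=
  sup [set `|l x| | x in [set x : V | `|x| <= 1]].

Lemma dual_linear (l : dual) : linear l.
Proof. by have /asboolP[] := dual_funP l. Qed.

Lemma dual_continuous (l : dual) : continuous l.
Proof. by have /asboolP[] := dual_funP l. Qed.

Lemma dual_fun0 (l : dual) : l 0 = 0.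
Proof. by have := dual_linear l (-1) 0 0; rewrite scaler0 addr0 scaleN1r addNr. Qed.

Lemma dual_funZ (l : dual) (a : R) (x : V) : l (a *: x) = a *: l x.
Proof. by have := dual_linear l a x 0; rewrite !addr0 dual_fun0 addr0. Qed.

Lemma dual_has_sup (l : dual) :
  has_sup [set `|l x| | x in [set x : V | `|x| <= 1]].
Proof.
split; first by exists `|l 0|, 0 => //=; rewrite normr0.
have /cvgrPdist_lt/(_ 1 ltr01)/nbhs_ballP[d /= d0 dl] :=
  @dual_continuous l 0.
exists (d / 2)^-1 => _ [x /= x1 <-].
have d20 : 0 < d / 2 by rewrite divr_gt0.
rewrite -[leRHS]mul1r ler_pdivlMr//.
have /dl : ball (0 : V) d ((d / 2) *: x).
  rewrite -ball_normE /= sub0r normrN normrZ gtr0_norm//.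
  by rewrite (le_lt_trans (ler_piMr _ _))// ?ltW// ltr_pdivrMr// ltr_pMr// ltr1n.
rewrite /= dual_fun0 sub0r normrN dual_funZ normrZ gtr0_norm// mulrC.
exact: ltW.
Qed.

Lemma dual_norm_ge (l : dual) (x : V) : `|x| <= 1 -> `|l x| <= dual_norm l.
Proof. by move=> x1; apply: (ub_le_sup (dual_has_sup l).2); exists x. Qed.

Lemma dual_norm_le (l : dual) (c : R) :
  (forall x : V, `|x| <= 1 -> `|l x| <= c) -> dual_norm l <= c.
Proof.
by move=> lc; apply: (ge_sup (dual_has_sup l).1) => _ [x /= x1 <-]; exact: lc.
Qed.

Lemma dual_normD (l m : dual) : dual_norm (l + m) <= dual_norm l + dual_norm m.
Proof.
apply: dual_norm_le => x x1; rewrite (le_trans (ler_normD _ _))//.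
by rewrite lerD ?dual_norm_ge.
Qed.

Lemma dual_normZ_le (a : R) (l : dual) :
  dual_norm (a *: l) <= `|a| * dual_norm l.
Proof.
apply: dual_norm_le => x x1; rewrite [leLHS]normrM.
by rewrite ler_wpM2l ?dual_norm_ge.
Qed.

Lemma dual_normZ (a : R) (l : dual) : dual_norm (a *: l) = `|a| * dual_norm l.
Proof.
apply/eqP; rewrite eq_le dual_normZ_le /=.
have [->|a0] := eqVneq a 0.
  rewrite normr0 mul0r; apply: le_trans (dual_norm_ge (0 *: l) (x := 0) _) => //.
  by rewrite normr0.
rewrite -ler_pdivlMl ?normr_gt0// -normfV.
by rewrite (le_trans _ (dual_normZ_le _ _))// scalerA mulVf// scale1r.
Qed.

Lemma dual_norm0_eq0 (l : dual) : dual_norm l = 0 -> l = 0.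
Proof.
move=> l0; apply/val_inj/funext => x /=.
have [->|x0] := eqVneq x 0; first exact: dual_fun0.
have := @dual_norm_ge l (`|x|^-1 *: x).
rewrite normrZ normfV normr_id mulVf ?normr_eq0// => /(_ (lexx _)).
rewrite l0 normr_le0 dual_funZ scaler_eq0 invr_eq0 normr_eq0 (negbTE x0) /=.
by move/eqP.
Qed.

HB.instance Definition _ := Lmodule_isNormed.Build R dual
  dual_normD dual_normZ dual_norm0_eq0.

End Dual.
Arguments dual {R} V.

Section BanachGeometry.
Context {R : realType}.
Implicit Types V : normedModType R.

Definition separable V := exists2 D : set V, countable D & dense D.

Definition reflexive_space V :=
  forall Phi : dual (dual V), exists x : V, forall l : dual V, Phi l = l x.

Definition uniformly_smooth V :=
  exists D : V -> V -> R, forall e : R, 0 < e ->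
    \forall t \near (0 : R)^', forall x0 h : V, `|x0| = 1 -> `|h| = 1 ->
      `| (`|x0 + t *: h| - `|x0|) / t - D x0 h | < e.

(* The gradient of the p-th power of the norm is taken to be its Frechet
   differential, which is a (continuous) form as soon as the differential
   exists, and has no meaning otherwise. *)
Definition Jp V (p : R) (x : V) : V -> R^o :=
  p^-1 *: ('d (fun y : V => (`|y| `^ p : R^o)) x : V -> R^o).

End BanachGeometry.

(* Elements of L^oo and L^1 are represented by strongly (Bochner) measurable
   functions on the whole line, of which only the values on D matter. Strong
   measurability is an almost everywhere limit of Borel simple functions, hence
   insensitive to modifications on Lebesgue-null sets. The integral of a
   function that is only Lebesgue measurable is the supremum over the Borel
   simple functions below it, which is its usual value. *)

Section VectorValued.
Context {R : realType}.
Implicit Types (V : normedModType R) (D : set (measurableTypeR R)).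
Local Notation mu := (@lebesgue_measure R).

Definition simple_on D V (s : R -> V) :=
  finite_set (s @` D) /\ forall v, measurable (D `&` s @^-1` [set v]).

Definition strongly_measurable D V (y : R -> V) :=
  exists s : nat -> R -> V, (forall n, simple_on D (s n)) /\
    {ae mu, forall t, D t -> s n t @[n --> \oo] --> y t}.

Definition ae_bounded D V (M : R) (y : R -> V) :=
  {ae mu, forall t, D t -> `|y t| <= M}.

Definition Linfty D V (y : R -> V) :=
  strongly_measurable D y /\ exists M, ae_bounded D M y.

Definition L1 D V (y : R -> V) :=
  strongly_measurable D y /\ (\int[mu]_(t in D) `|y t|%:E < +oo)%E.

Definition smoothly_weakly_compact D V (p : R) :=
  forall x : nat -> R -> V,
    (forall n, strongly_measurable D (x n)) ->
    (exists M, forall n, ae_bounded D M (x n)) ->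
  exists (k : nat -> nat) (y : R -> V),
    [/\ {homo k : m n / (m < n)%N},
        Linfty D y,
        forall psi : R -> dual V, L1 D psi ->
          \int[mu]_(t in D) (psi t (x (k n) t)) @[n --> \oo] -->
          \int[mu]_(t in D) (psi t (y t)) &
        forall (z : R -> V) (phi : R -> R^o), Linfty D z -> L1 D phi ->
          \int[mu]_(t in D)
            ((Jp p (z t + x (k n) t) - Jp p (x (k n) t)) (x (k n) t) * phi t)
            @[n --> \oo] -->
          \int[mu]_(t in D)
            ((Jp p (z t + y t) - Jp p (y t)) (y t) * phi t)].

Definition absolutely_continuous V (a b : R) (u : R -> V) :=
  forall e : R, 0 < e -> exists2 d : R, 0 < d &
    forall (n : nat) (s t : 'I_n -> R),
      (forall i, a <= s i /\ s i <= t i /\ t i <= b) ->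
      trivIset [set: 'I_n] (fun i => `]s i, t i[%classic) ->
      \sum_(i < n) (t i - s i) < d ->
      \sum_(i < n) `|u (t i) - u (s i)| < e.

End VectorValued.

Section ProxRegularity.
Context {R : realType} {V : normedModType R}.
Implicit Types (C : set V) (x y z v : V).

Definition dist x C : R := inf [set `|x - y| | y in C].

Definition proj C x : set V := [set y | C y /\ `|x - y| = dist x C].

Definition normal_cone C x : set V :=
  [set v | exists2 s : R, 0 < s & proj C (x + s *: v) x].

Definition Gamma (r : R) C x : set V := [set v | proj C (x + r *: v) x].

(* Since 0^-1 = 0, normalize 0 = 0. *)
Definition normalize v : V := `|v|^-1 *: v.

Definition prox_regular (r : R) (g : V -> V) C :=
  closed C /\
  forall x (s : R), C x -> 0 < s -> s < r ->
    let y := x + s *: normalize (g x) in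
    exists2 z, proj C y = [set z] & Gamma r C z (normalize (y - z)).

Definition ball_compact C :=
  forall x (rho : R), 0 < rho -> compact (closed_ball x rho `&` C).

(* Only the values of u on [0, T] matter: the endpoints, where 'D_1 u would see
   values outside, form a null set. *)
Definition sweeping_solution (T : R) (C : R -> set V) (f : V -> V) (u0 : V)
    (u : R -> V) :=
  [/\ absolutely_continuous 0 T u,
      u 0 = u0 &
      {ae (@lebesgue_measure R), forall t, `[0, T]%classic t ->
        derivable u t 1 /\
        exists2 v, normal_cone (C t) (u t) v & 'D_1 u t + v = f (u t)}].

End ProxRegularity.

(* Main.v *)
Require Import Defs.
From HB Require Import structures.
From mathcomp Require Import all_boot all_order all_algebra.
From mathcomp Require Import all_classical all_reals all_analysis.
From mathcomp Require Import measurable_realfun.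
From mathcomp Require Import ring lra.

(** Put v(t) = u(t) - t a: the constraint becomes the fixed set C0 and the
    field becomes g(t, x) = f(x + t a) - a. The catching-up scheme projects
    x_i + h g(t_i, x_i) onto C0. The first half of directional
    prox-regularity makes this projection a single point, and the second half
    says that the normal velocity w_i = g(t_i, x_i) - (x_{i+1} - x_i) / h
    satisfies, with one radius rho for all steps,
      rho |w_i| <= |x_{i+1} + rho w_i - c|     for every c in C0
    ([catching_up_step], [scheme]). A discrete Gronwall bound keeps positions
    and velocities bounded, so ball-compactness yields uniformly converging
    step functions ([uniform_subsequence]). The normal velocities converge
    only weakly-*, to some y. Both the equation and the displayed inequality
    have to survive this weak limit.

    The inequality is nonlinear in w_n. For z = (v - c) / rho it says that
    |z + w_n|^p >= |w_n|^p up to a uniformly small error. The derivative of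
      tau |-> |z + tau w|^p - |tau w|^p
    is p tau^(p-1) <J_p(z / tau + w) - J_p(w), w>, the very expression whose
    weak continuity defines smooth weak compactness. Integrating in tau is
    replaced by Riemann sums: convexity of |.|^p bounds their error by
    C / N uniformly in n and t ([normp_increment_Jp]), hence the integrals of
    (|z + w_n|^p - |w_n|^p) phi pass to the limit ([normp_weak_limit]). Thus
    |z + y| >= |y| almost everywhere for each c, then for all c at once by
    separability, and this is y(t) in N(C0, v(t)) ([ae_proximal_limit]).

    For the equation, testing against the forms l on [0, t] gives
    l(v(t) - v(0)) = int_0^t l(G) with G = g(., v) - y. To obtain v' = G
    almost everywhere, Lebesgue's differentiation theorem is applied to the
    real functions |G - d_k| for a dense sequence d_k
    ([ae_derivative_of_weak]). Passing from forms to norms uses that in a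
    uniformly smooth space the gradient of the norm at x is a form of norm
    one attaining |x| ([norm_gradient], [norm_le_of_dual]). *)

Set Implicit Arguments.
Unset Strict Implicit.
Unset Printing Implicit Defensive.

Import Order.TTheory GRing.Theory Num.Theory.
Import numFieldNormedType.Exports.

Local Open Scope classical_set_scope.
Local Open Scope ring_scope.

(** * The gradient of a uniformly smooth norm *)

Section NormGradient.
Context {R : realType} {V : normedModType R}.
Hypothesis V_smooth : uniformly_smooth V.
Implicit Types x y h : V.

(** Uniform smoothness is a statement about unit directions; rescaling h to
    its direction turns it into a first-order expansion in h. Using negative
    times as well makes the derivative odd. *)
Lemma norm_directional_derivative x : `|x| = 1 ->
  exists l : V -> R,
    [/\ forall c h, 0 <= c -> l (c *: h) = c * l h,
        forall h, l (- h) = - l h &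
        forall e, 0 < e -> exists2 d, 0 < d & forall h, `|h| < d ->
          `| `|x + h| - 1 - l h| <= e * `|h| ].
Proof.
move=> x1; have [D DP] := V_smooth.
pose l h : R := `|h| * D x (`|h|^-1 *: h).
have approx (e : R) : 0 < e -> exists2 d, 0 < d & forall h, `|h| < d ->
    `| `|x + h| - 1 - l h| <= e * `|h| /\ `| `|x + h| - 1 + l (- h)| <= e * `|h|.
  move=> e0; have := DP e e0; rewrite near_withinE near_simpl => /nbhs_ballP[d /= d0 dP].
  exists d => // h hd.
  have [->|h0] := eqVneq h 0.
    by rewrite /l oppr0 addr0 x1 normr0 !mul0r subrr subr0 normr0 mulr0 addr0 normr0.
  have nh0 : `|h| != 0 by rewrite normr_eq0.
  have nh : 0 < `|h| by rewrite normr_gt0.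
  have unit1 : `| `|h|^-1 *: h| = 1 by rewrite normrZ normfV normr_id mulVf.
  split.
    have := dP `|h|; rewrite -ball_normE /= sub0r normrN normr_id.
    move=> /(_ hd nh0 x _ x1 unit1).
    rewrite scalerA divff// scale1r x1 => /ltW E.
    rewrite -[X in X - l h](divfK nh0) /l (mulrC `|h| (D _ _)) -mulrBl normrM normr_id.
    by rewrite ler_wpM2r.
  have := dP (- `|h|); rewrite -ball_normE /= sub0r opprK normr_id oppr_eq0.
  move=> /(_ hd nh0 x (- (`|h|^-1 *: h)) x1).
  rewrite normrN unit1 => /(_ erefl).
  rewrite scalerN scaleNr opprK scalerA divff// scale1r x1 => /ltW E.
  rewrite -[X in X + l _](divfK nh0) /l normrN scalerN (mulrC `|h| (D _ _)).
  rewrite -mulrDl normrM normr_id.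
  by rewrite ler_wpM2r// (le_trans _ E)// invrN mulrN -opprD normrN.
have lZ (c : R) h : 0 <= c -> l (c *: h) = c * l h.
  rewrite le_eqVlt => /predU1P[<-|c0]; first by rewrite scale0r mul0r /l normr0 mul0r.
  rewrite /l normrZ gtr0_norm// -mulrA invfM scalerA; congr (_ * (_ * D _ (_ *: _))).
  by rewrite mulrAC mulVf ?mul1r// gt_eqF.
move: l approx lZ => l approx lZ; exists l; split => //.
- move=> h; apply/eqP; rewrite -addr_eq0 -normr_le0.
  apply/ler_addgt0Pr => e e0; rewrite add0r; have h1 : 0 < 2 * (`|h| + 1).
    by rewrite mulr_gt0// ltr_wpDl.
  have [d d0 dP] := approx (e / (2 * (`|h| + 1))) (divr_gt0 e0 h1).
  pose t := d / (2 * (`|h| + 1)).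
  have t0 : 0 < t by rewrite divr_gt0.
  have /dP : `|t *: h| < d.
    rewrite normrZ gtr0_norm// /t mulrAC ltr_pdivrMr// ltr_pM2l//.
    by have := normr_ge0 h; lra.
  rewrite -scalerN !lZ ?(ltW t0)// normrZ (gtr0_norm t0) => -[E1 E2].
  have : `|t * (l (- h) + l h)| <= 2 * (e / (2 * (`|h| + 1)) * (t * `|h|)).
    have -> : t * (l (- h) + l h) = (`|x + t *: h| - 1 + t * l (- h)) -
      (`|x + t *: h| - 1 - t * l h) by ring.
    by rewrite (le_trans (ler_normB _ _))// mulr_natl mulr2n lerD.
  rewrite normrM gtr0_norm// => E; rewrite -(ler_pM2l t0) (le_trans E)//.
  have -> : 2 * (e / (2 * (`|h| + 1)) * (t * `|h|)) = t * e * (`|h| / (`|h| + 1)).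
    by field; rewrite gt_eqF// ltr_wpDl.
  by rewrite ler_piMr ?mulr_ge0 ?ltW// ltr_pdivrMr ?mul1r ?ltrDl// ltr_wpDl.
- by move=> e /approx[d d0 dP]; exists d => // h /dP[].
Qed.

(** The derivative is odd and positively homogeneous, and convexity of the
    norm makes it subadditive, hence linear. It is bounded by the norm and
    equals 1 in the direction x, so it is a norming functional of x. *)
Lemma norm_gradient x : `|x| = 1 ->
  exists l : dual V,
    [/\ forall h, `|l h| <= `|h|,
        l x = 1 &
        forall e, 0 < e -> exists2 d, 0 < d & forall h, `|h| < d ->
          `| `|x + h| - 1 - l h| <= e * `|h| ].
Proof.
move=> x1; have [l [lZ lN lP]] := norm_directional_derivative x1.
(* Inequalities between homogeneous quantities may be proved up to the errors
   of the expansion at t h1, t h2, t h3, which are o(t). *)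
have small (a b : R) (h1 h2 h3 : V) :
    (forall t, 0 < t -> t * a <= t * b + `| `|x + t *: h1| - 1 - l (t *: h1)|
       + `| `|x + t *: h2| - 1 - l (t *: h2)| + `| `|x + t *: h3| - 1 - l (t *: h3)|) -> a <= b.
  move=> H; apply/ler_addgt0Pr => e e0.
  pose s := `|h1| + `|h2| + `|h3| + 1.
  have s0 : 0 < s by rewrite ltr_wpDl// !addr_ge0.
  have [d d0 dP] := lP (e / s) (divr_gt0 e0 s0).
  pose t := d / s; have t0 : 0 < t by rewrite divr_gt0.
  have nt h : `|t *: h| = t * `|h| by rewrite normrZ gtr0_norm.
  have td h : `|h| < s -> `|t *: h| < d.
    by move=> hs; rewrite normrZ gtr0_norm// /t mulrAC ltr_pdivrMr// ltr_pM2l.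
  have [n1 [n2 n3]] : 0 <= `|h1| /\ 0 <= `|h2| /\ 0 <= `|h3| by [].
  have E1 : `|h1| < s by rewrite /s; lra.
  have E2 : `|h2| < s by rewrite /s; lra.
  have E3 : `|h3| < s by rewrite /s; lra.
  have {E1}:= dP _ (td _ E1); have {E2}:= dP _ (td _ E2).
  have {E3}:= dP _ (td _ E3).
  rewrite !nt => F3 F2 F1; have := H t t0 => Ht.
  rewrite -(ler_pM2l t0) (le_trans Ht)//.
  have : e / s * (t * `|h1|) + e / s * (t * `|h2|) + e / s * (t * `|h3|) <= t * e.
    have -> : e / s * (t * `|h1|) + e / s * (t * `|h2|) + e / s * (t * `|h3|) =
       t * e * ((s - 1) / s) by rewrite /s; field; rewrite gt_eqF.
    rewrite ler_piMr//; first by rewrite mulr_ge0// ltW.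
    by rewrite ler_pdivrMr ?mul1r ?gerBl.
  move: F1 F2 F3; rewrite mulrDr.
  move: (e / s * (t * `|h1|)) (e / s * (t * `|h2|)) (e / s * (t * `|h3|)) => *.
  by lra.
have l0 : l 0 = 0 by have := lZ 0 0 (lexx _); rewrite scale0r mul0r.
have sub h k : l (h + k) <= l h + l k.
  apply: (@small _ _ (2 *: h) (2 *: k) (h + k)) => t t0.
  have -> : x + t *: (h + k) =
      2^-1 *: (x + t *: (2 *: h)) + 2^-1 *: (x + t *: (2 *: k)).
    have half u : 2^-1 *: (t *: (2 *: u)) = t *: u.
      by rewrite !scalerA; congr (_ *: _); field.
    rewrite !scalerDr !half addrACA -scalerDl.
    have -> : 2^-1 + 2^-1 = 1 :> R by lra.
    by rewrite scale1r.
  have := ler_normD (2^-1 *: (x + t *: (2 *: h))) (2^-1 *: (x + t *: (2 *: k))).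
  rewrite !normrZ gtr0_norm ?invr_gt0// !lZ ?(ltW t0)//.
  set A := `|x + t *: (2 *: h)|; set B := `|x + t *: (2 *: k)|; set C := `|_ + _|.
  have := ler_norm (A - 1 - t * (2 * l h)); have := ler_norm (B - 1 - t * (2 * l k)).
  have := ler_norm (- (C - 1 - t * l (h + k))); rewrite normrN.
  have := normr_ge0 (A - 1 - t * (2 * l h)); have := normr_ge0 (B - 1 - t * (2 * l k)).
  lra.
have le_norm h : l h <= `|h|.
  apply: (@small _ _ 0 0 h) => t t0; rewrite scaler0 addr0 l0 x1 lZ ?(ltW t0)//.
  have := ler_normD x (t *: h); rewrite normrZ gtr0_norm// x1.
  rewrite subrr sub0r oppr0 normr0.
  have := ler_norm (- ( `|x + t *: h| - 1 - t * l h)); rewrite normrN; lra.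
have add h k : l (h + k) = l h + l k.
  apply/eqP; rewrite eq_le sub /=.
  have := sub (h + k) (- k); rewrite addrK lN; lra.
have scal (c : R) h : l (c *: h) = c * l h.
  have [c0|c0] := leP 0 c; first exact: lZ.
  by rewrite -{1}[c]opprK scaleNr lN lZ ?oppr_ge0 ?(ltW c0)// mulNr opprK.
have bnd h : `|l h| <= `|h|.
  by rewrite ler_norml le_norm andbT -(normrN h) lerNl -lN le_norm.
have lin : linear (l : V -> R^o) by move=> c h k; rewrite add scal.
have cont : continuous (l : V -> R^o).
  move=> y; apply/cvgrPdist_lt => e e0; apply/nbhs_ballP; exists e => //= z.
  rewrite -ball_normE /= => yz.
  by rewrite -mulN1r -scal -add scaleN1r (le_lt_trans (bnd _)).
pose L := Dual (asboolT (conj lin cont)).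
exists L; split => //.
- apply/eqP; rewrite eq_le; apply/andP; split; first by rewrite (le_trans (le_norm x))// x1.
  apply: (@small _ _ 0 0 x) => t t0; rewrite scaler0 addr0 l0 x1 scal /=.
  have -> : `|x + t *: x| = 1 + t.
    by rewrite -[X in X + _]scale1r -scalerDl normrZ x1 mulr1 gtr0_norm// addr_gt0.
  have := ler_norm (1 + t - 1 - t * l x).
  by rewrite subrr subr0 normr0; lra.
Qed.

End NormGradient.

(** * Norming functionals and differentiability of powers of the norm *)

Section NormPower.
Context {R : realType} {V : normedModType R}.
Implicit Types x y h : V.

Lemma differentiable_of_estimate (F : V -> R^o) x (l : dual V) :
  (forall e : R, 0 < e -> exists2 d, 0 < d & forall h, `|h| < d ->
     `|F (x + h) - F x - l h| <= e * `|h|) ->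
  differentiable F x.
Proof.
move=> est.
pose lin := GRing.isLinear.Build R V R^o _ l (@dual_linear R V l).
pose l' : {linear V -> R^o} := HB.pack (l : V -> R^o) lin.
have fE : F \o shift x = cst (F x) + l' +o_ 0 id.
  apply/eqaddoP => e e0; have [d d0 dP] := est e e0.
  near=> h; rewrite /= !fctE /= (addrC h) opprD addrA.
  apply: dP; near: h; apply/nbhs_ballP; exists d => //= h.
  by rewrite -ball_normE /= sub0r normrN.
have dE : 'd F x = l :> (V -> R^o).
  by rewrite (diff_unique (df := l') _ fE)//; exact: dual_continuous.
by apply/diff_locallyP; rewrite dE; split => //; exact: dual_continuous.
Unshelve. all: by end_near. Qed.

Lemma dual_funB (l : dual V) x y : l (x - y) = l x - l y.
Proof.
have := dual_linear l (-1) y x; rewrite !scaleN1r => E.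
by rewrite addrC E addrC.
Qed.

Hypothesis V_smooth : uniformly_smooth V.

(** The gradient of the norm at x / |x| is one of the test forms, and its
    value at x is |x|. *)
Lemma norm_le_of_dual x (c : R) : 0 <= c ->
  (forall l : dual V, (forall h, `|l h| <= `|h|) -> l x <= c) -> `|x| <= c.
Proof.
move=> c0 lc; have [->|x0] := eqVneq x 0; first by rewrite normr0.
have [|l [lb l1 _]] := norm_gradient V_smooth (x := `|x|^-1 *: x).
  by rewrite normrZ normfV normr_id mulVf ?normr_eq0.
have := lc l lb; move: l1; rewrite dual_funZ => l1.
suff -> : l x = `|x| by [].
have nx0 : `|x| != 0 by rewrite normr_eq0.
by apply: (mulfI (invr_neq0 nx0)); rewrite mulVf.
Qed.

Lemma differentiable_norm x : x != 0 -> differentiable (fun y => `|y| : R^o) x.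
Proof.
move=> x0; have nx0 : 0 < `|x| by rewrite normr_gt0.
have [|l [_ _ lP]] := norm_gradient V_smooth (x := `|x|^-1 *: x).
  by rewrite normrZ normfV normr_id mulVf ?normr_eq0.
apply: (differentiable_of_estimate (l := l)) => e /lP[d d0 dP].
exists (d * `|x|) => [|h hd]; first by rewrite mulr_gt0.
pose k := `|x|^-1 *: h.
have hE : h = `|x| *: k by rewrite scalerA divff ?scale1r// gt_eqF.
have -> : `|x + h| - `|x| - l h = `|x| * ( `| `|x|^-1 *: x + k| - 1 - l k).
  rewrite !mulrBr mulr1 -[X in X * `|_ + _|]normr_id -normrZ scalerDr -hE.
  by rewrite scalerA divff ?gt_eqF// scale1r [X in l X]hE dual_funZ.
rewrite normrM normr_id [X in _ <= _ * `|X|]hE normrZ normr_id mulrCA ler_pM2l// dP//.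
by rewrite normrZ normfV normr_id mulrC ltr_pdivrMr.
Qed.

(** At the origin |h|^p is o(|h|) because p > 1; elsewhere the chain rule
    applies. *)
Lemma differentiable_normp (p : R) x : 1 < p ->
  differentiable (fun y => `|y| `^ p : R^o) x.
Proof.
move=> p1; have p0 : 0 < p by rewrite (lt_trans ltr01).
have [->|x0] := eqVneq x 0.
  apply: (differentiable_of_estimate (l := 0)) => e e0.
  exists (e `^ (p - 1)^-1); first exact: powR_gt0.
  move=> h hd; rewrite add0r normr0 powR0 ?gt_eqF// !subr0 ger0_norm ?powR_ge0//.
  rewrite -mulr_powRB1// mulrC ler_wpM2r//.
  have -> : e = (e `^ (p - 1)^-1) `^ (p - 1).
    by rewrite -powRrM mulVf ?powRr1 ?(ltW e0)// gt_eqF// subr_gt0.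
  by rewrite ge0_ler_powR ?nnegrE ?powR_ge0 ?(ltW hd)// subr_ge0 ltW.
rewrite [X in differentiable X _](_ : _ =
  (@powR R ^~ p : R^o -> R^o) \o (fun y : V => `|y| : R^o))//.
apply: differentiable_comp; first exact: differentiable_norm.
by apply/derivable1_diffP/derivable_powR; rewrite in_itv /= normr_gt0 x0.
Qed.

End NormPower.

(** * Increments of a power of the norm as sums of the duality map *)

Section PowR.
Context {R : realType} (p : R).
Hypothesis p1 : 1 <= p.

Lemma powR_convex (t a b : R) : 0 <= t <= 1 -> 0 <= a -> 0 <= b ->
  (t * a + (1 - t) * b) `^ p <= t * a `^ p + (1 - t) * b `^ p.
Proof.
move=> /andP[t0 t1] a0 b0.
by apply: (convex_powR p1 (Itv01 t0 t1)); rewrite /= inE /= in_itv /= andbT.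
Qed.

(** The point a lies on the chord from b to K + 1, whose horizontal length is
    at least 1; convexity bounds the increment by the one along the chord. *)
Lemma powR_lipschitz_le (K a b : R) : 0 <= b -> b <= a -> a <= K ->
  a `^ p - b `^ p <= (K + 1) `^ p * (a - b).
Proof.
move=> b0 ba aK; have d0 : 0 < K + 1 - b by lra.
(* a = t (K + 1) + (1 - t) b *)
pose t := (a - b) / (K + 1 - b).
have t01 : 0 <= t <= 1.
  by rewrite /t divr_ge0 ?(ltW d0) ?subr_ge0//= ler_pdivrMr// mul1r; lra.
have K0 : 0 <= K + 1 by lra.
have := powR_convex t01 K0 b0.
have -> : t * (K + 1) + (1 - t) * b = a by rewrite /t; field; rewrite gt_eqF.
have : t <= a - b by rewrite /t ler_pdivrMr// ler_peMr ?subr_ge0//; lra.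
have := powR_ge0 (K + 1) p; have := powR_ge0 b p.
have /andP[t0 _] := t01.
by move: (_ `^ p) (b `^ p) (a `^ p) => A B C *; nra.
Qed.

Lemma powR_lipschitz (K a b : R) : 0 <= a <= K -> 0 <= b <= K ->
  `|a `^ p - b `^ p| <= (K + 1) `^ p * `|a - b|.
Proof.
move=> /andP[a0 aK] /andP[b0 bK].
have p0 : 0 <= p by rewrite (le_trans ler01).
have mono (x y : R) : 0 <= x -> x <= y -> x `^ p <= y `^ p.
  by move=> x0 xy; rewrite ge0_ler_powR ?nnegrE// (le_trans x0).
have [ba|/ltW ab] := lerP b a.
  by rewrite !ger0_norm ?subr_ge0 ?mono// powR_lipschitz_le.
by rewrite !ler0_norm ?subr_le0 ?mono// !opprB powR_lipschitz_le.
Qed.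

End PowR.

Section NormPowerDifferential.
Context {R : realType} {V : normedModType R} (p : R).
Hypothesis V_smooth : uniformly_smooth V.
Hypothesis p1 : 1 < p.
Implicit Types x y z h : V.

Let Phi (y : V) : R^o := `|y| `^ p.

Let p0 : 0 < p. Proof. exact: lt_trans p1. Qed.

Let diffPhi x : differentiable Phi x.
Proof. exact: differentiable_normp. Qed.

Let PhiE (x : V) : (`|x| `^ p : R) = Phi x. Proof. by []. Qed.

Lemma normp_cvg x y :
  (fun h : R => h^-1 * (Phi (x + h *: y) - Phi x)) @ 0^' --> 'd Phi x y.
Proof.
rewrite -(deriveE y (diffPhi x)).
have := @diff_derivable _ _ _ Phi x y (diffPhi x).
by under eq_fun do rewrite /= [X in Phi X]addrC.
Qed.

(** The slopes of a convex function along a ray are nondecreasing, so their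
    limit at 0 is below the slope at time 1. *)
Lemma normp_subgradient x y : 'd Phi x y <= Phi (x + y) - Phi x.
Proof.
have /cvg_dnbhs_at_right cv := @normp_cvg x y.
rewrite -(cvg_lim _ cv)//; apply: limr_le; first by apply/cvg_ex; eexists; exact: cv.
near=> h.
have h0 : 0 < h by near: h; exact: nbhs_right_gt.
have h1 : h <= 1 by near: h; exact: nbhs_right_le.
rewrite ler_pdivrMl//.
have t01 : 0 <= h <= 1 by rewrite (ltW h0).
have := powR_convex (ltW p1) t01 (normr_ge0 (x + y)) (normr_ge0 x).
suff : Phi (x + h *: y) <= (h * `|x + y| + (1 - h) * `|x|) `^ p.
  by rewrite !PhiE; move: (Phi (x + h *: y)) (_ `^ p) (Phi _) (Phi x) => *; lra.
rewrite ge0_ler_powR ?nnegrE ?(ltW p0)//.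
  by rewrite addr_ge0// mulr_ge0// ?subr_ge0// ltW.
have -> : x + h *: y = h *: (x + y) + (1 - h) *: x.
  by rewrite scalerBl scale1r scalerDr [RHS]addrC addrA subrK.
rewrite (le_trans (ler_normD _ _))// !normrZ gtr0_norm// ger0_norm// subr_ge0.
Unshelve. all: by end_near. Qed.

Lemma normp_lipschitz (K : R) x y : `|x| <= K -> `|y| <= K ->
  `|Phi x - Phi y| <= (K + 1) `^ p * `|x - y|.
Proof.
move=> xK yK; rewrite (le_trans (powR_lipschitz (ltW p1) (K := K) _ _)) ?normr_ge0//.
by rewrite ler_wpM2l ?powR_ge0// ler_dist_dist.
Qed.

(** Differentiate |t x|^p = t^p |x|^p in x. *)
Lemma normp_diffZ (t : R) x y : 0 < t ->
  'd Phi (t *: x) y = t `^ (p - 1) * 'd Phi x y.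
Proof.
move=> t0; pose S : {linear V -> V} := *:%R t.
have S_cont : continuous S by exact: scaler_continuous.
have : 'd (Phi \o S) x = 'd Phi (S x) \o 'd S x :> (V -> R^o).
  by apply: diff_comp => //; exact: linear_differentiable.
rewrite (diff_lin _ S_cont).
have -> : Phi \o S = t `^ p *: Phi.
  apply/funext => u /=; rewrite /Phi normrZ gtr0_norm// powRM ?(ltW t0)//.
rewrite diffZ// => /(congr1 (@^~ y)) dE.
have {dE} : t `^ p * 'd Phi x y = t * 'd Phi (t *: x) y.
  by rewrite [LHS]dE /= linearZ.
by rewrite -(mulr_powRB1 (ltW t0) p0) -mulrA => /(mulfI (lt0r_neq0 t0)).
Qed.

(** By convexity the k-th term of the Riemann sum lies between two consecutive
    increments of the norm power along the segment from z to z + y. Both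
    bounds telescope, and they differ by the increments over the two end
    cells, which are of order 1 / n. The bound involves z and y only through
    K, which makes it uniform along a bounded sequence. *)
Lemma normp_riemann (K : R) z y n : `|z| <= K -> `|y| <= K ->
  `|Phi (z + y) - Phi z -
      n.+1%:R^-1 * \sum_(k < n.+1) 'd Phi (z + (k.+1%:R / n.+1%:R) *: y) y|
  <= 2 * (3 * K + 1) `^ p * K / n.+1%:R.
Proof.
move=> zK yK; set d := n.+1%:R^-1 : R.
have d0 : 0 < d by rewrite invr_gt0.
have d1 : d <= 1 by rewrite invf_le1 ?ler1n.
pose phi k := Phi (z + (k%:R * d) *: y).
pose m k := 'd Phi (z + (k.+1%:R * d) *: y) y.
have step k : phi k.+1 = Phi (z + (k%:R * d) *: y + d *: y).
  by rewrite /phi -addrA -scalerDl mulrSr mulrDl mul1r.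
have lo k : phi k.+1 - phi k <= d * m k.
  have := normp_subgradient (z + (k.+1%:R * d) *: y) (- (d *: y)).
  rewrite [X in X <= _]linearN linearZ /= -/(m k) -/(phi k.+1).
  rewrite [X in Phi X](_ : _ = z + (k%:R * d) *: y) -/(phi k).
    by rewrite /GRing.scale /=; lra.
  by rewrite -addrA -scalerBl mulrSr mulrDl mul1r addrK.
have up k : d * m k <= phi k.+2 - phi k.+1.
  by rewrite step; have := normp_subgradient (z + (k.+1%:R * d) *: y) (d *: y);
     rewrite [X in X <= _]linearZ.
have telescope (j : nat) : \sum_(k < n.+1) 
    (phi (k + j).+1 - phi (k + j)%N) = phi (n.+1 + j)%N - phi j.
  rewrite -(big_mkord xpredT (fun k => phi (k + j).+1 - phi (k + j)%N)).
  by rewrite (telescope_sumr (fun k => phi (k + j)%N)).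
have S1 : phi n.+1 - phi 0 <= d * \sum_(k < n.+1) m k.
  have := telescope 0%N; rewrite addn0 => <-; rewrite mulr_sumr.
  by apply: ler_sum => k _; rewrite addn0.
have S2 : d * \sum_(k < n.+1) m k <= phi n.+2 - phi 1.
  have := telescope 1%N; rewrite addn1 => <-; rewrite mulr_sumr.
  by apply: ler_sum => k _; rewrite addn1.
have K0 : 0 <= K by rewrite (le_trans _ zK).
have bnd (c : R) : 0 <= c -> c <= 2 -> `|z + c *: y| <= 3 * K.
  move=> c0 c2; rewrite (le_trans (ler_normD _ _))// normrZ ger0_norm//.
  by have := ler_pM c0 (normr_ge0 y) c2 yK; lra.
have lip (b c : R) : 0 <= b -> b <= 2 -> 0 <= c -> c <= 2 ->
    `|Phi (z + b *: y) - Phi (z + c *: y)| <= (3 * K + 1) `^ p * (`|b - c| * K).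
  move=> b0 b2 c0 c2; rewrite (le_trans (normp_lipschitz (bnd _ b0 b2) (bnd _ c0 c2)))//.
  rewrite ler_wpM2l ?powR_ge0// opprD addrACA subrr add0r -scalerBl normrZ.
  by rewrite ler_wpM2l.
have nd : n.+1%:R * d = 1 by rewrite divff.
have n2d : n.+2%:R * d = 1 + d by rewrite mulrSr mulrDl nd mul1r.
have E1 : phi n.+2 - phi n.+1 <= (3 * K + 1) `^ p * (d * K).
  rewrite (le_trans (ler_norm _))// (le_trans (lip _ _ _ _ _ _))// ?n2d ?nd; try lra.
  by rewrite addrAC subrr add0r gtr0_norm.
have E2 : phi 0 - phi 1 <= (3 * K + 1) `^ p * (d * K).
  rewrite (le_trans (ler_norm _))// (le_trans (lip _ _ _ _ _ _))// ?mul0r ?mul1r; try lra.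
  by rewrite sub0r normrN gtr0_norm.
have -> : Phi (z + y) = phi n.+1 by rewrite /phi nd scale1r.
have -> : Phi z = phi 0 by rewrite /phi mul0r scale0r addr0.
rewrite distrC ger0_norm ?subr_ge0//.
have -> : 2 * (3 * K + 1) `^ p * K * d = 2 * ((3 * K + 1) `^ p * (d * K)) by ring.
move: S2 E1 E2; rewrite /m; lra.
Qed.

(** Subtracting the Riemann sums for z and for 0 and using the homogeneity of
    the differential makes appear the expressions controlled by smooth weak
    compactness, at the rescaled points z / tau. Right endpoints are used so
    that tau never vanishes. *)
Lemma normp_increment_Jp (K : R) z y n : `|z| <= K -> `|y| <= K ->
  `|Phi (z + y) - Phi z - Phi y -
      \sum_(k < n.+1) (p * n.+1%:R^-1 * (k.+1%:R / n.+1%:R) `^ (p - 1)) *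
        (Jp p ((k.+1%:R / n.+1%:R)^-1 *: z + y) - Jp p y) y|
  <= 4 * (3 * K + 1) `^ p * K / n.+1%:R.
Proof.
move=> zK yK; have K0 : 0 <= K by rewrite (le_trans _ zK).
have := normp_riemann n zK yK.
have := @normp_riemann K 0 y n; rewrite normr0 => /(_ K0 yK).
rewrite add0r; have -> : Phi 0 = 0 by rewrite /Phi normr0 powR0 ?gt_eqF.
rewrite subr0; set S0 := _ * \sum_(k < n.+1) _; set Sz := _ * \sum_(k < n.+1) _.
move=> E0 Ez.
set S := \sum_(k < n.+1) _.
have -> : S = Sz - S0.
  rewrite /S /Sz /S0 -mulrBr -sumrB mulr_sumr; apply: eq_bigr => k _.
  rewrite add0r.
  have t0 : 0 < k.+1%:R / n.+1%:R :> R by rewrite divr_gt0.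
  set t := _ / _ in t0 *.
  have -> : (Jp p (t^-1 *: z + y) - Jp p y) y =
      p^-1 * ('d Phi (t^-1 *: z + y) y - 'd Phi y y) by rewrite mulrBr.
  have -> : 'd Phi (z + t *: y) y = t `^ (p - 1) * 'd Phi (t^-1 *: z + y) y.
    by rewrite -normp_diffZ// scalerDr scalerA divff ?gt_eqF// scale1r.
  have -> : 'd Phi (t *: y) y = t `^ (p - 1) * 'd Phi y y.
    exact: normp_diffZ.
  move: ('d Phi y y) ('d Phi (_ *: z + y) y) (t `^ (p - 1)) => A B D.
  by field; rewrite !gt_eqF.
have -> : Phi (z + y) - Phi z - Phi y - (Sz - S0) =
  (Phi (z + y) - Phi z - Sz) - (Phi y - S0) by ring.
rewrite (le_trans (ler_normB _ _))//.
rewrite (le_trans (lerD Ez E0))// le_eqVlt; apply/orP; left; apply/eqP.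
by ring.
Qed.

(** A sequence of difference quotients, which makes the duality map
    measurable along measurable curves. *)
Lemma Jp_cvg x y :
  (fun n => p^-1 * (n.+1%:R * (Phi (x + n.+1%:R^-1 *: y) - Phi x))) @ \oo --> Jp p x y.
Proof.
apply: cvgMl_tmp.
have harm : (fun n => n.+1%:R^-1 : R) @ \oo --> (0 : R)^'.
  move=> A /nbhs_ballP[e /= e0 eA].
  have := @cvg_harmonic R => /cvgrPdist_lt/(_ e e0); apply: filterS => n.
  by move=> ne; apply: eA; rewrite -?ball_normE//= invr_eq0.
have := cvg_comp _ _ harm (@normp_cvg x y).
rewrite [X in X @ _ --> _ -> _](_ : _ =
  (fun n => n.+1%:R * (Phi (x + n.+1%:R^-1 *: y) - Phi x)))//.
by apply/funext => n /=; rewrite invrK.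
Qed.

Lemma Jp_bound (K : R) x y : `|x| <= K -> `|y| <= K ->
  `|Jp p x y| <= (2 * K + 1) `^ p * K.
Proof.
move=> xK yK.
have bnd u : `|u| <= K -> `|x + u| <= 2 * K.
  by move=> uK; rewrite (le_trans (ler_normD _ _))//; lra.
have x2K : `|x| <= 2 * K by have := bnd 0; rewrite normr0 addr0; have := normr_ge0 x; lra.
have half u : `|u| <= K -> 'd Phi x u <= (2 * K + 1) `^ p * K.
  move=> uK; rewrite (le_trans (normp_subgradient x u))// (le_trans (ler_norm _))//.
  rewrite (le_trans (normp_lipschitz (bnd _ uK) x2K))// ler_wpM2l ?powR_ge0//.
  by rewrite addrAC subrr add0r.
have dK : `|'d Phi x y| <= (2 * K + 1) `^ p * K.
  rewrite ler_norml half// andbT lerNl.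
  by have := @half (- y); rewrite normrN linearN; exact.
rewrite (_ : Jp p x y = p^-1 * 'd Phi x y)// normrM gtr0_norm ?invr_gt0//.
by rewrite (le_trans _ dK)// ler_piMl// invf_le1// ltW.
Qed.

Lemma normp_continuous : continuous Phi.
Proof. by move=> x; exact/differentiable_continuous/diffPhi. Qed.

End NormPowerDifferential.

(** * Null sets and pointwise limits of simple functions *)

Section NullSet.
Context d (T : measurableType d) (R : realType) (mu : {measure set T -> \bar R}).
Import HBNNSimple.

(** The integral of f is the supremum of those of the simple functions below
    f; multiplying a simple function by the indicator of the complement of N
    does not change its integral. *)
Lemma ge0_integral_setD_null (D N : set T) (f : T -> \bar R) :
  measurable N -> mu N = 0%E -> (forall x, D x -> (0 <= f x)%E) ->
  (\int[mu]_(x in D) f x = \int[mu]_(x in D `\` N) f x)%E.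
Proof.
move=> mN muN f0; rewrite !ge0_integralE//; last by move=> x [/f0].
have mNc : measurable (~` N) by exact: measurableC.
apply/eqP; rewrite eq_le; apply/andP; split; last first.
  apply: le_ereal_sup => _ [h /= hf <-]; exists h => // x.
  rewrite (le_trans (hf x))// !patchE; case: ifPn => [|_].
    by rewrite in_setE => -[Dx _]; rewrite mem_set.
  by case: ifPn => // /set_mem; exact: f0.
apply: ge_ereal_sup => _ [h /= hf <-].
have -> : sintegral mu h = sintegral mu (proj_nnsfun h mNc).
  transitivity (\int[mu]_x (h x)%:E)%E.
    by rewrite integral_nnsfun// patch_setT.
  rewrite (ge0_negligible_integral mN)//; last 2 first.
  - exact/measurable_EFinP.
  - by move=> x _; rewrite lee_fin.
  by rewrite setTD integral_nnsfun// mrestrict.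
apply: ereal_sup_ubound; exists (proj_nnsfun h mNc) => //= x.
rewrite /= mindicE patchE; have [xN|xN] := boolP (x \in ~` N); last first.
  rewrite mulr0; case: ifPn => // /set_mem [Dx _]; exact: f0.
rewrite mulr1 (le_trans (hf x))// patchE; case: ifPn => [/set_mem Dx|Dx].
  by rewrite mem_set//; split => //; exact: set_mem xN.
by case: ifPn => // /set_mem[] /mem_set; rewrite (negPf Dx).
Qed.

(** A weak limit is only almost everywhere equal to a Borel function; this is
    how integrals along it are reduced to integrals of Borel functions. *)
Lemma integral_setD_null (D N : set T) (f : T -> \bar R) :
  measurable N -> mu N = 0%E ->
  (\int[mu]_(x in D) f x = \int[mu]_(x in D `\` N) f x)%E.
Proof.
move=> mN muN; rewrite integralE [RHS]integralE.
by rewrite (ge0_integral_setD_null mN)// (@ge0_integral_setD_null _ _ f^\-%E mN).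
Qed.

Lemma Rintegral_setD_null (D N : set T) (f : T -> R) :
  measurable N -> mu N = 0%E ->
  \int[mu]_(x in D) f x = \int[mu]_(x in D `\` N) f x.
Proof. by move=> mN muN; rewrite /Rintegral (integral_setD_null _ _ mN). Qed.

End NullSet.

Section PointwiseLimits.
Context d (T : measurableType d) (R : realType).
Implicit Types E : set T.

(** The values lie in an arbitrary type, so that pairs of simple functions and
    membership tests are simple functions too. *)
Definition simple_fun (W : Type) E (s : T -> W) :=
  finite_set (s @` E) /\ forall w, measurable (E `&` s @^-1` [set w]).

(** Limits at every point of E, which makes these functions stable under
    pairing and under continuous maps without any exceptional set. *)
Definition simple_limit (W : topologicalType) E (y : T -> W) :=
  exists s : nat -> T -> W, (forall n, simple_fun E (s n)) /\
    forall t, E t -> s n t @[n --> \oo] --> y t.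

Lemma simple_fun_preimage (W : Type) E (s : T -> W) (Y : set W) :
  simple_fun E s -> measurable (E `&` s @^-1` Y).
Proof.
move=> [fs ms].
rewrite [X in measurable X](_ : _ = \bigcup_(w in s @` E `&` Y) (E `&` s @^-1` [set w])).
  apply: fin_bigcup_measurable => //; exact: finite_setIl.
apply/seteqP; split => [t [Et Yt]|t [w [_ Yw] [Et st]]].
  by exists (s t) => //; split => //; exists t.
by split => //=; rewrite [s t]st.
Qed.

Lemma simple_fun_comp (W W' : Type) E (s : T -> W) (h : W -> W') :
  simple_fun E s -> simple_fun E (h \o s).
Proof.
move=> ss; split; first by rewrite -image_comp; exact: finite_image ss.1.
by move=> w; rewrite comp_preimage; exact: simple_fun_preimage.
Qed.

Lemma simple_fun_pair (W W' : Type) E (s : T -> W) (s' : T -> W') :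
  simple_fun E s -> simple_fun E s' -> simple_fun E (fun t => (s t, s' t)).
Proof.
move=> [fs ms] [fs' ms']; split.
  apply: (sub_finite_set _ (finite_setX fs fs')).
  by move=> _ [t Et <-]; split; exists t.
move=> [w w']; rewrite [X in measurable X](_ : _ =
  (E `&` s @^-1` [set w]) `&` (E `&` s' @^-1` [set w'])); first exact: measurableI.
by apply/seteqP; split => [t [Et [<- <-]]|t [[Et <-] [_ <-]]].
Qed.

Lemma simple_limit_simple (W : topologicalType) E (s : T -> W) :
  simple_fun E s -> simple_limit E s.
Proof. by move=> ss; exists (fun=> s); split => // t _; exact: cvg_cst. Qed.

Lemma simple_limit_comp (W W' : topologicalType) E (y : T -> W) (h : W -> W') :
  continuous h -> simple_limit E y -> simple_limit E (h \o y).
Proof.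
move=> hc [s [ss sy]]; exists (fun n => h \o s n); split.
  by move=> n; exact: simple_fun_comp.
by move=> t Et; apply: continuous_cvg; [exact: hc|exact: sy].
Qed.

Lemma simple_limit_pair (W W' : topologicalType) E (y : T -> W) (z : T -> W') :
  simple_limit E y -> simple_limit E z -> simple_limit E (fun t => (y t, z t)).
Proof.
move=> [s [ss sy]] [s' [ss' sz]]; exists (fun n t => (s n t, s' n t)); split.
  by move=> n; exact: simple_fun_pair.
by move=> t Et; apply: cvg_pair; [exact: sy|exact: sz].
Qed.

Lemma simple_limit_measurable E (y : T -> R) : measurable E ->
  simple_limit E y -> measurable_fun E y.
Proof.
move=> mE [s [ss sy]]; apply: (measurable_fun_cvg (h := s)) => //.
by move=> n _ Y mY; exact: simple_fun_preimage.
Qed.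

End PointwiseLimits.

(** * Bounded measurable functions and representatives *)

Section BoundedMeasurable.
Context d (T : measurableType d) (R : realType) (mu : {measure set T -> \bar R}).
Variable E : set T.
Hypothesis mE : measurable E.
Hypothesis muE : (mu E < +oo)%E.
Implicit Types f g : T -> R.

Definition bounded_measurable f :=
  measurable_fun E f /\ exists K : R, forall t, E t -> `|f t| <= K.

Lemma bounded_measurable_integrable f : bounded_measurable f ->
  mu.-integrable E (EFin \o f).
Proof.
move=> [mf [K fK]]; apply: measurable_bounded_integrable => //.
exists K; split; first exact: num_real.
by move=> x Kx t Et /=; rewrite (le_trans (fK t Et))// ltW.
Qed.

Lemma bounded_measurableM f g : bounded_measurable f -> bounded_measurable g ->
  bounded_measurable (fun t => f t * g t).
Proof.
move=> [mf [K fK]] [mg [L gL]]; split; first exact: measurable_funM.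
by exists (K * L) => t Et; rewrite normrM ler_pM ?fK ?gL.
Qed.

Lemma bounded_measurableB f g : bounded_measurable f -> bounded_measurable g ->
  bounded_measurable (fun t => f t - g t).
Proof.
move=> [mf [K fK]] [mg [L gL]]; split; first exact: measurable_funB.
exists (K + L) => t Et; rewrite (le_trans (ler_normB _ _))// lerD ?fK ?gL//.
Qed.

Lemma bounded_measurableD f g : bounded_measurable f -> bounded_measurable g ->
  bounded_measurable (fun t => f t + g t).
Proof.
move=> [mf [K fK]] [mg [L gL]]; split; first exact: measurable_funD.
exists (K + L) => t Et; rewrite (le_trans (ler_normD _ _))// lerD ?fK ?gL//.
Qed.

Lemma bounded_measurable_cst c : bounded_measurable (fun=> c).
Proof. by split; [exact: measurable_cst|exists `|c|]. Qed.

Lemma bounded_measurable_indic A : measurable A -> bounded_measurable (\1_A : T -> R).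
Proof.
move=> mA; split; first exact: measurable_indic.
by exists 1 => t _; rewrite indicE; case: (_ \in _); rewrite ?normr1 ?normr0.
Qed.

Lemma bounded_measurable_sum n (f : nat -> T -> R) :
  (forall k, bounded_measurable (f k)) ->
  bounded_measurable (fun t => \sum_(k < n) f k t).
Proof.
move=> fb; elim: n => [|n IH].
  under eq_fun do rewrite big_ord0; exact: bounded_measurable_cst.
by under eq_fun do rewrite big_ord_recr /=; exact: bounded_measurableD.
Qed.

Lemma Rintegral_sum n (f : nat -> T -> R) :
  (forall k, bounded_measurable (f k)) ->
  \int[mu]_(t in E) (\sum_(k < n) f k t) = \sum_(k < n) \int[mu]_(t in E) f k t.
Proof.
move=> fb; elim: n => [|n IH].
  rewrite big_ord0; under eq_Rintegral do rewrite big_ord0.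
  by rewrite Rintegral_cst// mul0r.
rewrite big_ord_recr/= -IH -RintegralD//; last 2 first.
- exact/bounded_measurable_integrable/bounded_measurable_sum.
- exact/bounded_measurable_integrable.
by under eq_Rintegral do rewrite big_ord_recr/=.
Qed.

Lemma Rintegral_bound f (K : R) : measurable_fun E f ->
  (forall t, E t -> `|f t| <= K) -> `|\int[mu]_(t in E) f t| <= K * fine (mu E).
Proof.
move=> mf fK; have fb : bounded_measurable f by split => //; exists K.
rewrite (le_trans (le_normr_Rintegral mE _))//; first exact: bounded_measurable_integrable.
rewrite -Rintegral_cst//; apply: le_Rintegral => //.
- apply: bounded_measurable_integrable; split; first exact: measurableT_comp.
  by exists K => t Et; rewrite normr_id fK.
- exact/bounded_measurable_integrable/bounded_measurable_cst.
Qed.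

End BoundedMeasurable.

(** Interchange of limits, when v q approximates u uniformly in n. *)
Lemma cvg_of_approx (R : realType) (u : nat -> R) (l : R)
    (v : nat -> nat -> R) (m : nat -> R) (e : nat -> R) :
  e @ \oo --> 0 -> (forall q n, `|u n - v q n| <= e q) ->
  (forall q, `|l - m q| <= e q) -> (forall q, v q @ \oo --> m q) ->
  u @ \oo --> l.
Proof.
move=> e0 uv lm vm; apply/cvgrPdist_le => eps eps0.
have e3 : 0 < eps / 3 by rewrite divr_gt0.
move/cvgrPdist_le : e0 => /(_ _ e3) [q _ /(_ q (leqnn q))].
rewrite sub0r normrN => eq.
have := vm q => /cvgrPdist_le/(_ _ e3); apply: filterS => n vn.
have -> : l - u n = (l - m q) + (m q - v q n) - (u n - v q n) by ring.
rewrite (le_trans (ler_normB _ _))// (le_trans (lerD (ler_normD _ _) (lexx _)))//.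
have := uv q n; have := lm q; have := ler_norm (e q).
by move: `|l - _| `|m q - _| `|u n - _| eq vn => a b c; lra.
Qed.

Section Representatives.
Context {R : realType} {V : normedModType R}.
Local Notation mu := (@lebesgue_measure R).
Implicit Types (D N : set (measurableTypeR R)).

Lemma simple_limit_Linfty D (z : R -> V) (M : R) :
  simple_limit D z -> (forall t, D t -> `|z t| <= M) -> Linfty D z.
Proof.
move=> [s [ss sz]] zM; split; last by exists M; exact: aeW.
by exists s; split => //; exact: aeW.
Qed.

Lemma simple_L1 D (z : R -> V) (M : R) : measurable D -> (mu D < +oo)%E ->
  simple_fun D z -> (forall t, D t -> `|z t| <= M) -> L1 D z.
Proof.
move=> mD muD zs zM; split.
  by exists (fun=> z); split => //; apply: aeW => t _; exact: cvg_cst.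
have zm : measurable_fun D (fun t => `|z t|).
  apply: simple_limit_measurable => //; apply: simple_limit_simple.
  exact: (simple_fun_comp (fun v => `|v|) zs).
apply: (@le_lt_trans _ _ (\int[mu]_(t in D) (`|M|%:E))%E).
  apply: ge0_le_integral => //; first exact/measurable_EFinP.
  by move=> t Dt; rewrite lee_fin (le_trans (zM t Dt))// ler_norm.
by rewrite integral_cst// lte_mul_pinfty.
Qed.

Lemma simple_fun_if (W : Type) D E (s s' : R -> W) : measurable E ->
  simple_fun D s -> simple_fun D s' ->
  simple_fun D (fun t => if t \in E then s t else s' t).
Proof.
move=> mE ss ss'; have sE : simple_fun D (fun t => t \in E).
  split.
    apply: (sub_finite_set _ (finite_set2 true false)) => _ [t _ <-].
    by case: (_ \in _); [left|right].
  have mD : measurable D by rewrite -[D]setIT; exact: (simple_fun_preimage setT ss).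
  move=> b; apply: measurableI => //; case: b.
    rewrite [X in measurable X](_ : _ = E)//; apply/seteqP.
    by split => t /=; [exact: set_mem|exact: mem_set].
  rewrite [X in measurable X](_ : _ = ~` E); first exact: measurableC.
  by apply/seteqP; split => t /=; [move=> /negbT; rewrite notin_setE|
    move=> nE; apply/negbTE; rewrite notin_setE].
exact: (simple_fun_comp (fun u : bool * (W * W) => if u.1 then u.2.1 else u.2.2)
  (simple_fun_pair sE (simple_fun_pair ss ss'))).
Qed.

Lemma simple_fun_cst (W : Type) D (w : W) : measurable D -> simple_fun D (fun=> w).
Proof.
move=> mD; split; first by apply: (sub_finite_set _ (finite_set1 w)) => _ [t _ <-].
move=> w'; have [->|ww'] := pselect (w = w').
  by rewrite [X in measurable X](_ : _ = D)//; apply/seteqP; split => t // [].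
by rewrite [X in measurable X](_ : _ = set0)//; apply/seteqP; split => t // [].
Qed.

(** The function is set to 0 on the null set where its simple approximations
    fail to converge or where it exceeds its essential bound. *)
Lemma Linfty_representative D (y : R -> V) : measurable D -> Linfty D y ->
  exists (N : set (measurableTypeR R)) (y' : R -> V) (K : R),
    [/\ measurable N, mu N = 0%E, (forall t, (D `\` N) t -> y t = y' t),
        simple_limit D y' & forall t, D t -> `|y' t| <= K].
Proof.
move=> mD [[s [ss [N1 [mN1 N10 sN]]]] [K [N2 [mN2 N20 KN]]]].
pose N := N1 `|` N2; pose E := ~` N.
have mN : measurable N by exact: measurableU.
have mE : measurable E by exact: measurableC.
have inE' t : t \in E -> ~ N1 t /\ ~ N2 t by move=> /set_mem/not_orP.
exists N, (fun t => if t \in E then y t else 0), (Num.max K 0); split => //.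
- by apply/eqP; rewrite -measure_le0 (le_trans (measureU2 _ _ _))//= ?N10 ?N20 ?adde0.
- by move=> t [_ Nt]; rewrite mem_set.
- exists (fun n t => if t \in E then s n t else 0); split => [n|t Dt].
    exact: simple_fun_if (ss n) (simple_fun_cst _ _).
  case: ifPn => [tE|_]; last exact: cvg_cst.
  by have [N1t _] := inE' t tE; apply: contrapT => st; apply/N1t/sN => /(_ Dt).
- move=> t Dt; rewrite le_max; case: ifPn => [/inE'[_ N2t]|_].
    by apply/orP; left; apply: contrapT => st; apply/N2t/KN => /(_ Dt).
  by rewrite normr0 lexx orbT.
Qed.

Lemma Rintegral_representative D N (f f' : R -> R) :
  measurable N -> mu N = 0%E -> (forall t, (D `\` N) t -> f t = f' t) ->
  \int[mu]_(t in D) f t = \int[mu]_(t in D) f' t.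
Proof.
move=> mN muN ff'; rewrite (Rintegral_setD_null D f mN muN).
rewrite (Rintegral_setD_null D f' mN muN); apply: eq_Rintegral => t.
by rewrite inE => /ff'.
Qed.

End Representatives.

(** * Passing to the limit in increments of a power of the norm *)

Section WeakLimit.
Context {R : realType} {V : normedModType R} (p : R).
Local Notation mu := (@lebesgue_measure R).
Hypothesis V_smooth : uniformly_smooth V.
Hypothesis p1 : 1 < p.

(** Pointwise limit of difference quotients of the norm power, each of which
    is a continuous function of the pair of x and y. *)
Lemma Jp_measurable (E : set (measurableTypeR R)) (x y : R -> V) : measurable E ->
  simple_limit E x -> simple_limit E y ->
  measurable_fun E (fun t => Jp p (x t) (y t) : R).
Proof.
move=> mE lx ly.
apply: (measurable_fun_cvg (h := fun n t =>
    p^-1 * (n.+1%:R * ( `|x t + n.+1%:R^-1 *: y t| `^ p - `|x t| `^ p)))); last first.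
  by move=> t _; exact: Jp_cvg.
move=> n; apply: simple_limit_measurable => //.
apply: (simple_limit_comp (h := fun u : V * V =>
    (p^-1 * (n.+1%:R * ( `|u.1 + n.+1%:R^-1 *: u.2| `^ p - `|u.1| `^ p)) : R))
    _ (simple_limit_pair lx ly)).
move=> u; apply: cvgMl_tmp; apply: cvgMl_tmp.
have norm_cont (g : V * V -> V) : g v @[v --> u] --> g u ->
    ( `|g v| `^ p : R^o) @[v --> u] --> ( `|g u| `^ p : R^o).
  by move=> gu; exact: cvg_comp gu (normp_continuous V_smooth p1 (x := g u)).
apply: cvgB; apply: norm_cont; last exact: cvg_fst.
by apply: cvgD; [exact: cvg_fst|apply: cvgZl_tmp; exact: cvg_snd].
Qed.

Lemma normp_measurable (E : set (measurableTypeR R)) (x : R -> V) : measurable E ->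
  simple_limit E x -> measurable_fun E (fun t => `|x t| `^ p).
Proof.
move=> mE lx; apply: simple_limit_measurable => //.
apply: (simple_limit_comp (h := fun v : V => ( `|v| `^ p : R)) _ lx).
exact: normp_continuous.
Qed.

Lemma simple_limitD (E : set (measurableTypeR R)) (x y : R -> V) :
  simple_limit E x -> simple_limit E y -> simple_limit E (fun t => x t + y t).
Proof.
move=> lx ly; apply: (simple_limit_comp (h := fun u : V * V => u.1 + u.2) _
  (simple_limit_pair lx ly)).
by move=> u; apply: cvgD; [exact: cvg_fst|exact: cvg_snd].
Qed.

Lemma simple_limitZ (E : set (measurableTypeR R)) (c : R) (x : R -> V) :
  simple_limit E x -> simple_limit E (fun t => c *: x t).
Proof.
move=> lx; apply: (simple_limit_comp (h := fun u : V => c *: u) _ lx).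
exact: scaler_continuous.
Qed.

Variables (D A : set (measurableTypeR R)) (x : nat -> R -> V) (y z : R -> V) (M K : R).
Hypothesis mD : measurable D.
Hypothesis muD : (mu D < +oo)%E.
Hypothesis mA : measurable A.
Hypothesis x_simple : forall n, simple_fun D (x n).
Hypothesis x_bounded : forall n t, D t -> `|x n t| <= M.
Hypothesis y_limit : simple_limit D y.
Hypothesis y_bounded : forall t, D t -> `|y t| <= K.
Hypothesis z_limit : simple_limit D z.
Hypothesis z_bounded : forall t, D t -> `|z t| <= M.
Hypothesis Jp_limit : forall (z : R -> V) (phi : R -> R^o),
  Linfty D z -> L1 D phi ->
  \int[mu]_(t in D)
     ((Jp p (z t + x n t) - Jp p (x n t)) (x n t) * phi t)
     @[n --> \oo] -->
  \int[mu]_(t in D) ((Jp p (z t + y t) - Jp p (y t)) (y t) * phi t).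

(** Up to an error of order 1 / q, uniform in n, the integrand is |z|^p plus
    a sum over k of multiples of (J_p(z / tau_k + x) - J_p(x))(x). For each
    fixed q the integrals of these finitely many terms converge. *)
Lemma normp_weak_limit :
  \int[mu]_(t in D) (( `|z t + x n t| `^ p - `|x n t| `^ p) * \1_A t)
     @[n --> \oo] -->
  \int[mu]_(t in D) (( `|z t + y t| `^ p - `|y t| `^ p) * \1_A t).
Proof.
pose K0 := Num.max M K.
pose good (w : R -> V) := simple_limit D w /\ forall t, D t -> `|w t| <= K0.
have good_x n : good (x n).
  split; first exact: simple_limit_simple.
  by move=> t Dt; rewrite le_max x_bounded.
have good_y : good y by split => // t Dt; rewrite le_max y_bounded// orbT.
have good_z : good z by split => // t Dt; rewrite le_max z_bounded.
pose F (w : R -> V) t : R := `|z t + w t| `^ p - `|w t| `^ p.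
pose G c (w : R -> V) t : R := (Jp p (c *: z t + w t) - Jp p (w t)) (w t).
have bm_np (w : R -> V) c : simple_limit D w -> (forall t, D t -> `|w t| <= c) ->
    bounded_measurable D (fun t => `|w t| `^ p : R).
  move=> lw wc; split; first exact: normp_measurable.
  exists (c `^ p) => t Dt; rewrite ger0_norm ?powR_ge0//.
  have p0 : 0 <= p by rewrite ltW// (lt_trans _ p1).
  by rewrite ge0_ler_powR ?nnegrE ?wc// (le_trans _ (wc t Dt)).
have bm_A : bounded_measurable D (\1_A : R -> R) by exact: bounded_measurable_indic.
have bm_F w : good w -> bounded_measurable D (fun t => F w t * \1_A t).
  move=> [lw wK]; apply: bounded_measurableM => //; apply: bounded_measurableB.
    apply: (bm_np _ (K0 + K0)); first exact: simple_limitD good_z.1 lw.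
    by move=> t Dt; rewrite (le_trans (ler_normD _ _))// lerD ?wK//; exact: good_z.2.
  exact: (bm_np _ K0).
have bm_G c w : good w -> bounded_measurable D (fun t => G c w t * \1_A t).
  move=> [lw wK]; apply: bounded_measurableM => //; apply: bounded_measurableB.
    split.
      apply: Jp_measurable => //; apply: simple_limitD => //.
      by apply: simple_limitZ; exact: good_z.1.
    exists ((2 * (( `|c| + 1) * K0) + 1) `^ p * (( `|c| + 1) * K0)) => t Dt.
    have K00 : 0 <= K0 by exact: le_trans (wK t Dt).
    apply: Jp_bound => //; last by rewrite (le_trans (wK t Dt))// ler_peMl// lerDr.
    rewrite (le_trans (ler_normD _ _))// mulrDl mul1r lerD ?wK// normrZ.
    by rewrite ler_wpM2l//; exact: good_z.2.
  split; first exact: Jp_measurable.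
  by exists ((2 * K0 + 1) `^ p * K0) => t Dt; apply: Jp_bound => //; exact: wK.
have bm_zA : bounded_measurable D (fun t => `|z t| `^ p * \1_A t).
  by apply: bounded_measurableM => //; exact: (bm_np _ K0 good_z.1 good_z.2).
pose tau (q k : nat) : R := k.+1%:R / q.+1%:R.
pose cst (q k : nat) : R := p * q.+1%:R^-1 * tau q k `^ (p - 1).
pose S q w := \sum_(k < q.+1) cst q k * \int[mu]_(t in D) (G (tau q k)^-1 w t * \1_A t)
  + \int[mu]_(t in D) ( `|z t| `^ p * \1_A t).
pose err q := 4 * (3 * K0 + 1) `^ p * K0 / q.+1%:R * fine (mu D).
have approx q w : good w -> `|\int[mu]_(t in D) (F w t * \1_A t) - S q w| <= err q.
  move=> gw; have [lw wK] := gw.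
  pose term k t : R := cst q k * (G (tau q k)^-1 w t * \1_A t).
  have bm_term k : bounded_measurable D (term k).
    by apply: bounded_measurableM; [exact: bounded_measurable_cst|exact: bm_G].
  have bm_sum : bounded_measurable D (fun t => \sum_(k < q.+1) term k t).
    exact: (bounded_measurable_sum _ bm_term).
  have bm_S := bounded_measurableD bm_sum bm_zA.
  have -> : S q w = \int[mu]_(t in D)
      (\sum_(k < q.+1) term k t + `|z t| `^ p * \1_A t).
    rewrite RintegralD//; last 2 first.
    - exact: bounded_measurable_integrable bm_sum.
    - exact: bounded_measurable_integrable bm_zA.
    rewrite (Rintegral_sum _ _ _ bm_term)//.
    congr (_ + _); apply: eq_bigr => k _; rewrite RintegralZl//.
    exact/bounded_measurable_integrable/bm_G.
  rewrite -RintegralB//; last 2 first.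
  - exact/bounded_measurable_integrable/bm_F.
  - exact: bounded_measurable_integrable bm_S.
  apply: Rintegral_bound => //.
    by have [] := bounded_measurableB (bm_F _ gw) bm_S.
  move=> t Dt; have K00 : 0 <= K0 by exact: le_trans (wK t Dt).
  rewrite [X in `|X|](_ : _ = ( `|z t + w t| `^ p - `|z t| `^ p - `|w t| `^ p -
      \sum_(k < q.+1) cst q k * G (tau q k)^-1 w t) * \1_A t); last first.
    rewrite [RHS]mulrBl mulr_suml [X in _ = _ - X](eq_bigr (fun k : 'I__ => term k t)).
      by rewrite /F; ring.
    by move=> k _; rewrite /term mulrA.
  rewrite normrM -[leRHS]mulr1 ler_pM//.
    exact: (normp_increment_Jp V_smooth p1 q (good_z.2 t Dt) (wK t Dt)).
  by rewrite indicE; case: (_ \in _); rewrite ?normr1 ?normr0.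
apply: (@cvg_of_approx _ _ _ (fun q n => S q (x n)) (S^~ y) err).
- rewrite -[X in _ --> X](mul0r (fine (mu D))); apply: cvgMr_tmp.
  rewrite -[X in _ --> X](mulr0 (4 * (3 * K0 + 1) `^ p * K0)); apply: cvgMl_tmp.
  exact: cvg_harmonic.
- by move=> q n; exact: approx.
- by move=> q; exact: approx.
move=> q; apply: cvgD; last exact: cvg_cst.
have term k : cst q k * \int[mu]_(t in D) (G (tau q k)^-1 (x n) t * \1_A t) @[n --> \oo]
    --> cst q k * \int[mu]_(t in D) (G (tau q k)^-1 y t * \1_A t).
  apply: cvgMl_tmp.
  have zL : Linfty D (fun t => (tau q k)^-1 *: z t).
    apply: (@simple_limit_Linfty _ _ _ _ ( `|(tau q k)^-1| * M)).
      exact: simple_limitZ.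
    by move=> t Dt; rewrite normrZ ler_wpM2l// z_bounded.
  have AL : L1 D (\1_A : R -> R^o).
    apply: (@simple_L1 _ R^o _ _ 1) => //.
      split; first by apply: (sub_finite_set _ (finite_set2 0 1)) => _ [t _ <-];
        rewrite indicE; case: (_ \in _); [right|left].
      move=> w; have mi : measurable_fun D (\1_A : R -> R) by exact: measurable_indic.
      exact: mi mD _ (measurable_set1 w).
    by move=> t _; rewrite indicE; case: (_ \in _); rewrite ?normr1 ?normr0.
  exact: Jp_limit zL AL.
by apply: cvg_big => [|k _]; [exact: add_continuous|exact: term].
Qed.

End WeakLimit.

(** * The catching-up scheme *)

Section CatchingUp.
Context {R : realType} {V : normedModType R}.
Implicit Types (C : set V) (x y z c w : V).

Lemma dist_le C y c : C c -> dist y C <= `|y - c|.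
Proof.
by move=> Cc; apply: ge_inf; [exists 0 => _ [? _ <-]|exists c].
Qed.

(** The inequality rho |w| <= |z + rho w - c| over c in C says that z is a
    projection of z + rho w on C. This form involves neither a distance nor
    the normalization of w, and can be passed to the limit in z and w. *)
Definition proximal_at C (rho : R) z w :=
  forall c, C c -> rho * `|w| <= `|z + rho *: w - c|.

Lemma proximal_normal_cone C (rho : R) z w : 0 < rho -> C z ->
  proximal_at C rho z w -> normal_cone C z w.
Proof.
move=> rho0 Cz zw; exists rho => //; split=> //.
have nE : `|z + rho *: w - z| = rho * `|w|.
  by rewrite addrAC subrr add0r normrZ gtr0_norm.
apply/eqP; rewrite eq_le dist_le// andbT; apply: lb_le_inf.
  by exists `|z + rho *: w - z|, z.
by move=> _ [c Cc <-]; rewrite nE; exact: zw.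
Qed.

(** With y = x + h g(x) and z its projection, the normal velocity w is
    (y - z) / h. The membership in Gamma is an inequality at radius r in the
    direction of w, and the triangle inequality carries it to all smaller
    radii. *)
Lemma catching_up_step (r h : R) (g : V -> V) C x : prox_regular r g C -> C x ->
  0 < h -> h * `|g x| < r ->
  exists z, [/\ C z, `|z - x| <= 2 * h * `|g x|,
    `|g x - h^-1 *: (z - x)| <= `|g x| &
    forall rho : R, 0 <= rho -> rho * `|g x| <= r ->
      proximal_at C rho z (g x - h^-1 *: (z - x))].
Proof.
move=> [_ prox] Cx h0 hr.
have [gx0|gx0] := eqVneq (g x) 0.
  exists x; rewrite gx0 normr0 mulr0 subrr normr0 scaler0 subr0 normr0; split => //.
  by move=> rho _ _ c _; rewrite normr0 mulr0.
have ngx : 0 < `|g x| by rewrite normr_gt0.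
have [z] := prox x (h * `|g x|) Cx (mulr_gt0 h0 ngx) hr.
have -> : x + (h * `|g x|) *: normalize (g x) = x + h *: g x.
  by rewrite /normalize scalerA mulfK ?gt_eqF.
set y := x + h *: g x => projE.
have [Cz yz] : Defs.proj C y z by rewrite projE.
set w := g x - h^-1 *: (z - x).
have wE : w = h^-1 *: (y - z).
  rewrite /w /y !scalerBr scalerDr scalerA mulVf ?gt_eqF// scale1r.
  by rewrite opprB addrA [g x + _]addrC.
have yzE : `|y - z| = h * `|w|.
  by rewrite wE normrZ gtr0_norm ?invr_gt0// mulrA divff ?gt_eqF// mul1r.
have yz_le : `|y - z| <= h * `|g x|.
  rewrite yz (le_trans (dist_le y Cx))// /y addrAC subrr add0r normrZ.
  by rewrite gtr0_norm.
have w_le : `|w| <= `|g x| by rewrite -(ler_pM2l h0) -yzE.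
move=> [_ gam]; exists z; split => //.
  have -> : z - x = (y - x) - (y - z) by rewrite opprB [RHS]addrC subrKA.
  rewrite (le_trans (ler_normB _ _))//.
  have -> : `|y - x| = h * `|g x| by rewrite /y addrAC subrr add0r normrZ gtr0_norm.
  lra.
move=> rho rho0 rhor c Cc; rewrite -/w.
have [w0|w0] := eqVneq w 0; first by rewrite w0 normr0 mulr0.
have nw : 0 < `|w| by rewrite normr_gt0.
have nE : normalize (y - z) = `|w|^-1 *: w.
  rewrite /normalize yzE (_ : y - z = h *: w); last first.
    by rewrite wE scalerA divff ?gt_eqF// scale1r.
  by rewrite scalerA invfM mulrAC mulVf ?mul1r// gt_eqF.
have : r <= `|z + r *: (`|w|^-1 *: w) - c|.
  have := dist_le (z + r *: normalize (y - z)) Cc; rewrite -gam nE addrAC subrr add0r.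
  rewrite normrZ normrZ normfV normr_id mulVf ?gt_eqF// mulr1 => /(le_trans _); apply.
  exact: ler_norm.
have -> : z + r *: (`|w|^-1 *: w) - c =
    (z + rho *: w - c) + (r * `|w|^-1 - rho) *: w.
  by rewrite scalerBl scalerA ![z + _ - c]addrAC -[RHS]addrA subrKC.
have rw : 0 <= r / `|w| - rho.
  rewrite subr_ge0 ler_pdivlMr// (le_trans _ rhor)// ler_wpM2l//.
move=> /le_trans/(_ (ler_normD _ _)); rewrite normrZ ger0_norm// mulrBl divfK ?gt_eqF//.
lra.
Qed.

End CatchingUp.

Section Scheme.
Context {R : realType} {V : normedModType R} (C0 : set V) (g : R -> V -> V).
Variables (T r L' : R) (u0 : V).
Hypothesis T0 : 0 < T.
Hypothesis L'0 : 0 < L'.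
Hypothesis g_prox : forall t, 0 <= t <= T -> prox_regular r (g t) C0.
Hypothesis g_growth : forall t x, 0 <= t <= T -> `|g t x| <= L' * (1 + `|x|).
Hypothesis C0u0 : C0 u0.

(** The Gronwall constant: the norms 1 + |x_i| grow at most by the factor
    1 + 2 h L' at each step, and (1 + 2 h L')^(T/h) <= exp (2 T L'). *)
Definition velocity_bound := L' * (expR (2 * T * L') * (1 + `|u0|)).
Local Notation M := velocity_bound.

Lemma velocity_bound_gt0 : 0 < M.
Proof. by rewrite !mulr_gt0 ?expR_gt0// ltr_wpDr. Qed.

(** Boundedness of the positions and admissibility of the next step
    (h |g| < r) are proved by one induction, since each needs the other. *)
Lemma scheme n (h := T / n.+1%:R) : h * M < r ->
  exists X : nat -> V, [/\ X 0 = u0,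
    forall i, (i <= n.+1)%N -> C0 (X i) &
    forall i, (i <= n)%N ->
      let gi := g (i%:R * h) (X i) in
      [/\ `|gi| <= M, `|X i.+1 - X i| <= 2 * h * M,
          `|gi - h^-1 *: (X i.+1 - X i)| <= M &
          forall rho, 0 <= rho -> rho * M <= r ->
            proximal_at C0 rho (X i.+1) (gi - h^-1 *: (X i.+1 - X i))]].
Proof.
move=> hM; have h0 : 0 < h by rewrite divr_gt0.
pose Q i x z := [/\ C0 z, `|z - x| <= 2 * h * `|g (i%:R * h) x|,
    `|g (i%:R * h) x - h^-1 *: (z - x)| <= `|g (i%:R * h) x| &
    forall rho : R, 0 <= rho -> rho * `|g (i%:R * h) x| <= r ->
      proximal_at C0 rho z (g (i%:R * h) x - h^-1 *: (z - x))].
pose X := fix X i := if i is j.+1 then xget u0 (Q j (X j)) else u0.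
have iT i : (i <= n)%N -> 0 <= i%:R * h <= T.
  move=> iN; rewrite mulr_ge0 ?(ltW h0)//= mulrA ler_pdivrMr// mulrC ler_pM2l//.
  by rewrite ler_nat (leq_trans iN).
have growth i : (i <= n)%N -> 1 + `|X i| <= (1 + 2 * h * L') ^+ i * (1 + `|u0|) ->
    `|g (i%:R * h) (X i)| <= M.
  move=> iN Xi; rewrite (le_trans (g_growth _ (iT i iN)))// /M ler_pM2l//.
  rewrite (le_trans Xi)// ler_wpM2r ?addr_ge0//.
  have b1 : 1 <= 1 + 2 * h * L' by rewrite lerDl !mulr_ge0// ltW.
  rewrite (le_trans (ler_weXn2l b1 (leq_trans iN (leqnSn n))))//.
  have -> : 2 * T * L' = n.+1%:R * (2 * h * L') by rewrite /h; field; rewrite nat1r.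
  by rewrite expRM_natl lerXn2r ?nnegrE ?expR_ge0 ?expR_ge1Dx ?(le_trans _ b1).
have step i : (i <= n)%N -> C0 (X i) ->
    1 + `|X i| <= (1 + 2 * h * L') ^+ i * (1 + `|u0|) -> Q i (X i) (X i.+1).
  move=> iN CX /(growth i iN) gM; rewrite /=; apply: xgetPex.
  apply: (catching_up_step (g_prox (iT i iN)) CX h0).
  by rewrite (le_lt_trans _ hM)// ler_pM2l.
have inv i : (i <= n.+1)%N ->
    C0 (X i) /\ 1 + `|X i| <= (1 + 2 * h * L') ^+ i * (1 + `|u0|).
  elim: i => [_|i IH iN]; first by rewrite expr0 mul1r.
  have [CX Xi] := IH (ltnW iN); have [CX' X' _ _] := step i iN CX Xi.
  split => //; rewrite exprS -mulrA (le_trans (y := (1 + 2 * h * L') * (1 + `|X i|)))//.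
    rewrite -[X i.+1](subrK (X i)) -lerBrDl (le_trans (ler_normD _ _))//.
    rewrite (le_trans (lerD X' (lexx _)))//.
    have := g_growth (X i) (iT i iN); rewrite -(ler_pM2l (mulr_gt0 (ltr0n R 2) h0)).
    move: `|g _ _| `|X i| => a b; lra.
  by rewrite ler_wpM2l// addr_ge0// !mulr_ge0// ltW.
exists X; split => // [i /inv[]//|i iN gi].
have [CX Xi] := inv i (leqW iN).
have [_ X1 X2 X3] := step i iN CX Xi; have gM := growth i iN Xi.
split => //.
- by rewrite (le_trans X1)// ler_pM2l// mulr_gt0.
- exact: le_trans X2 gM.
- by move=> rho rho0 rM; apply: X3 => //; rewrite (le_trans _ rM)// ler_wpM2l.
Qed.

End Scheme.

(** * Approximate solutions as step functions *)

Section Interval.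
Context {R : realType} (T : R).
Local Notation mu := (@lebesgue_measure R).
Local Notation D := (`[0, T]%classic : set (measurableTypeR R)).

Lemma mu_itv_fin (i : interval R) : [set` i] `<=` D -> (mu [set` i] < +oo)%E.
Proof.
move=> iD; apply: (@le_lt_trans _ _ (mu D)).
  by rewrite le_measure// inE; exact: measurable_itv.
rewrite lebesgue_measure_itv/=; case: ifP => // _; by rewrite -EFinB ltry.
Qed.

Lemma subitv_co (a b : R) : 0 <= a -> b <= T -> `[a, b[ `<=` D.
Proof.
move=> a0 bT t; rewrite /= !in_itv/= => /andP[at_ tb].
by rewrite (le_trans a0 at_) (le_trans (ltW tb) bT).
Qed.

Lemma bounded_measurableS (E F : set (measurableTypeR R)) (f : R -> R) :
  measurable E -> measurable F -> F `<=` E ->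
  bounded_measurable E f -> bounded_measurable F f.
Proof.
move=> mE mF FE [mf [K fK]]; split; first exact: measurable_funS mf.
by exists K => t /FE; exact: fK.
Qed.

Lemma integrable_co (f : R -> R) (a b : R) : bounded_measurable D f ->
  0 <= a -> b <= T -> mu.-integrable `[a, b[ (EFin \o f).
Proof.
move=> fb a0 bT; apply: bounded_measurable_integrable.
- exact: measurable_itv.
- exact/mu_itv_fin/subitv_co.
- by apply: bounded_measurableS fb => //; exact: subitv_co.
Qed.

Lemma Rintegral_co_split (f : R -> R) (a b c : R) : bounded_measurable D f ->
  0 <= a -> a <= b -> b <= c -> c <= T ->
  \int[mu]_(t in `[a, c[) f t = \int[mu]_(t in `[a, b[) f t + \int[mu]_(t in `[b, c[) f t.
Proof.
move=> fb a0 ab bc cT.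
have E : `[a, c[%classic = `[a, b[%classic `|` `[b, c[%classic.
  by apply: itv_bndbnd_setU; rewrite bnd_simp.
rewrite E; apply: Rintegral_setU.
- exact: measurable_itv.
- exact: measurable_itv.
- by rewrite -E; exact: integrable_co.
- apply/disj_setPS => t [] /=; rewrite !in_itv/= => /andP[_ tb] /andP[bt _].
  by move: tb; rewrite ltNge bt.
Qed.

Lemma Rintegral_co_bound (f : R -> R) (a b K : R) : bounded_measurable D f ->
  0 <= a -> a <= b -> b <= T -> (forall t, D t -> `|f t| <= K) ->
  `| \int[mu]_(t in `[a, b[) f t| <= K * (b - a).
Proof.
move=> fb a0 ab bT fK.
have [mf _] : bounded_measurable `[a, b[ f.
  by apply: bounded_measurableS fb => //; exact: subitv_co.
apply: (@le_trans _ _ (K * fine (mu `[a, b[))).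
  apply: Rintegral_bound => //; [exact/mu_itv_fin/subitv_co|].
  by move=> t abt; apply/fK/(subitv_co a0 bT).
have K0 : 0 <= K.
  rewrite (le_trans (normr_ge0 (f 0)))// fK//= in_itv/= lexx/=.
  by rewrite (le_trans a0)// (le_trans ab).
rewrite ler_wpM2l// lebesgue_measure_itv/=; case: ifP => //= _.
by rewrite subr_ge0.
Qed.

Lemma Rintegral_co_cst (f : R -> R) (a b k : R) : a < b ->
  (forall t, a <= t < b -> f t = k) ->
  \int[mu]_(t in `[a, b[) f t = k * (b - a).
Proof.
move=> ab fk; rewrite (eq_Rintegral _ (g := fun=> k)).
  rewrite Rintegral_cst; last exact: measurable_itv.
  by rewrite /= lebesgue_measure_itv/= lte_fin ab.
by move=> t; rewrite inE /= in_itv/= => /fk.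
Qed.

End Interval.

Section Grid.
Context {R : realType} (T : R) (n : nat).
Hypothesis T0 : 0 < T.
Local Notation D := (`[0, T]%classic : set (measurableTypeR R)).
Local Notation h := (T / n.+1%:R).

(** Index of the cell of [0, T] containing t; the minimum puts the endpoint T
    in the last cell. *)
Definition grid_index (t : R) : nat := minn (Num.truncn (t / h)) n.

Lemma mesh_gt0 : 0 < h. Proof. by rewrite divr_gt0. Qed.

Lemma grid_index_le t : (grid_index t <= n)%N. Proof. exact: geq_minr. Qed.

Lemma grid_index_bounds t : 0 <= t <= T ->
  (grid_index t)%:R * h <= t <= (grid_index t).+1%:R * h.
Proof.
move=> /andP[t0 tT]; have h0 := mesh_gt0.
have th0 : 0 <= t / h by rewrite divr_ge0// ltW.
have /andP[lo up] := truncn_itv th0.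
have lo' : (grid_index t)%:R <= t / h by rewrite (le_trans _ lo)// ler_nat geq_minl.
have up' : t / h <= (grid_index t).+1%:R.
  rewrite /grid_index /minn; case: ifP => _; first exact: ltW.
  by rewrite ler_pdivrMr// mulrC divfK.
by rewrite -(ler_pdivlMr _ _ h0) -(ler_pdivrMr _ _ h0) lo' up'.
Qed.

Lemma grid_index_eq j t : (j <= n)%N -> j%:R * h <= t < j.+1%:R * h ->
  grid_index t = j.
Proof.
move=> jn; have h0 := mesh_gt0.
rewrite -ler_pdivlMr// -ltr_pdivrMr// => /truncn_def E.
by rewrite /grid_index E; apply/minn_idPl.
Qed.

Lemma grid_index_homo (s t : R) : s <= t -> (grid_index s <= grid_index t)%N.
Proof.
move=> st; rewrite /grid_index leq_min geq_minr andbT geq_min.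
by rewrite le_truncn// ler_pM2r// invr_gt0 mesh_gt0.
Qed.

Lemma grid_index0 : grid_index 0 = 0%N.
Proof. by apply: grid_index_eq => //; rewrite mul0r lexx mul1r mesh_gt0. Qed.

Lemma grid_index_simple : simple_fun D grid_index.
Proof.
split.
  apply: (sub_finite_set _ (finite_II n.+1)) => _ [t _ <-] /=.
  by rewrite ltnS grid_index_le.
move=> k; apply: measurableI; first exact: measurable_itv.
apply: is_interval_measurable => s t /= sk tk u /andP[su ut]; apply/eqP.
by rewrite eqn_leq -{1}tk -{1}sk !grid_index_homo.
Qed.

Lemma step_simple (W : Type) (X : nat -> W) : simple_fun D (X \o grid_index).
Proof. exact: simple_fun_comp grid_index_simple. Qed.

End Grid.

Section ApproximateSolution.
Context {R : realType} {V : normedModType R} (C0 : set V) (g : R -> V -> V).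
Variables (T r L' : R) (u0 : V).
Local Notation mu := (@lebesgue_measure R).
Local Notation D := (`[0, T]%classic : set (measurableTypeR R)).
Local Notation M := (velocity_bound T L' u0).

(** The step functions x, x', w, v take on the cell [t_i, t_{i+1}[ the values
    x_i, x_{i+1}, w_i and g(t_i, x_i). The last field is the integrated
    equation tested against a form of norm at most 1; it is exact at the nodes
    and holds inside a cell up to a multiple of the mesh h. *)
Record approximate_solution (rho h : R) (x x' w v : R -> V) : Prop := {
  as_x : simple_fun D x;
  as_w : simple_fun D w;
  as_v : simple_fun D v;
  as_start : x 0 = u0;
  as_mem : forall t : R, D t -> C0 (x t);
  as_v_le : forall t : R, D t -> `|v t| <= M;
  as_w_le : forall t : R, D t -> `|w t| <= M;
  as_next : forall t : R, D t -> `|x' t - x t| <= 2 * h * M;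
  as_prox : forall t : R, D t -> proximal_at C0 rho (x' t) (w t);
  as_lip : forall s t : R, D s -> D t -> `|x s - x t| <= 2 * M * ( `|s - t| + h);
  as_field : forall t : R, D t -> exists2 s : R, 0 <= s <= T &
    `|s - t| <= h /\ v t = g s (x t);
  as_weak : forall (l : dual V) (t : R), (forall y, `|l y| <= `|y|) -> D t ->
    `| l (x t) - l u0 - \int[mu]_(s in `[0, t[) (l (v s) - l (w s) : R)| <= 2 * h * M
}.

Hypothesis T0 : 0 < T.
Hypothesis L'0 : 0 < L'.
Hypothesis g_prox : forall t, 0 <= t <= T -> prox_regular r (g t) C0.
Hypothesis g_growth : forall t x, 0 <= t <= T -> `|g t x| <= L' * (1 + `|x|).
Hypothesis C0u0 : C0 u0.

(** The integral of l(v) - l(w) telescopes over the cells because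
    v - w is the difference quotient of the scheme. *)
Lemma approximate_solution_exists rho n (h := T / n.+1%:R) :
  h * M < r -> 0 <= rho -> rho * M <= r ->
  exists x x' w v, approximate_solution rho h x x' w v.
Proof.
move=> hM rho0 rhoM; have h0 : 0 < h by exact: mesh_gt0.
have M0 : 0 < M by exact: velocity_bound_gt0.
have [X [X0 XC XP]] := scheme T0 L'0 g_prox g_growth C0u0 hM.
pose G i := g (i%:R * h) (X i); pose W i := G i - h^-1 *: (X i.+1 - X i).
pose idx := @grid_index R T n.
have DE (t : R) : D t -> 0 <= t <= T by rewrite /= in_itv.
exists (X \o idx), (X \o succn \o idx), (W \o idx), (G \o idx).
have idxn t : (idx t <= n)%N by exact: grid_index_le.
have idxb (t : R) : D t -> (idx t)%:R * h <= t <= (idx t).+1%:R * h.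
  by move=> /DE; exact: grid_index_bounds.
split; try exact: step_simple.
- by rewrite /= /idx grid_index0.
- by move=> t _; apply: XC; exact: leqW.
- by move=> t _; have [] := XP _ (idxn t).
- by move=> t _; have [] := XP _ (idxn t).
- by move=> t _; have [] := XP _ (idxn t).
- by move=> t _; have [_ _ _] := XP _ (idxn t); exact.
- have jump i k : (i + k <= n.+1)%N -> `|X (i + k)%N - X i| <= k%:R * (2 * h * M).
    elim: k => [|k IH] ikn; first by rewrite addn0 subrr normr0 mul0r.
    have -> : X (i + k.+1)%N - X i = (X (i + k).+1 - X (i + k)%N) + (X (i + k)%N - X i).
      by rewrite addnS addrA addrNK.
    rewrite (le_trans (ler_normD _ _))// mulrSr mulrDl mul1r addrC lerD//.
      by apply: IH; rewrite (leq_trans _ ikn)// addnS.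
    by have [] := XP (i + k)%N; rewrite // -ltnS -addnS.
  suff mono (s t : R) : D s -> D t -> s <= t ->
      `|X (idx t) - X (idx s)| <= 2 * M * (t - s + h).
    move=> s t Ds Dt; have [st|/ltW ts] := lerP s t; last exact: mono.
    by rewrite distrC; exact: mono.
  move=> Ds Dt st; have ij : (idx s <= idx t)%N by exact: grid_index_homo.
  have := jump (idx s) (idx t - idx s)%N; rewrite subnKC// => /(_ (leqW (idxn t))).
  move=> /le_trans; apply.
  have -> : (idx t - idx s)%:R * (2 * h * M) = 2 * M * ((idx t)%:R * h - (idx s)%:R * h).
    by rewrite natrB//; ring.
  rewrite (ler_pM2l (mulr_gt0 (ltr0n R 2) M0)).
  have /andP[_ su] := idxb s Ds; have /andP[tl _] := idxb t Dt.
  by move: su; rewrite -natr1 mulrDl mul1r; lra.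
- move=> t Dt; exists ((idx t)%:R * h).
    have /DE/andP[_ tT] := Dt; have /andP[lo _] := idxb t Dt.
    by rewrite mulr_ge0 ?(ltW h0)// (le_trans lo).
  split => //; have /andP[lo up] := idxb t Dt.
  by rewrite ler0_norm ?subr_le0// opprB; move: up; rewrite -natr1 mulrDl mul1r; lra.
move=> l t lb Dt.
pose F s : R := l (h^-1 *: ((X \o succn \o idx) s - (X \o idx) s)).
have FE s : l ((G \o idx) s) - l ((W \o idx) s) = F s.
  rewrite /F /= /W.
  by rewrite -dual_funB opprB addrC subrK.
rewrite (_ : (fun s => _) = F); last by apply/funext => s; exact: FE.
have F_le s : `|F s| <= 2 * M.
  rewrite (le_trans (lb _))// normrZ gtr0_norm ?invr_gt0//.
  have [_ X2 _ _] := XP _ (idxn s).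
  by rewrite ler_pdivrMl// (le_trans X2)// [h * _]mulrA [h * 2]mulrC.
have Fb : bounded_measurable D F.
  split; last by exists (2 * M).
  apply: simple_limit_measurable; first exact: measurable_itv.
  apply: simple_limit_simple.
  exact: (step_simple n T0 (fun i => l (h^-1 *: (X i.+1 - X i)))).
have hT : n.+1%:R * h = T by rewrite mulrC divfK.
have node j : (j <= n.+1)%N ->
    \int[mu]_(s in `[0, j%:R * h[) F s = l (X j) - l u0.
  elim: j => [_|j IH jn].
    by rewrite mul0r set_itvco0 Rintegral_set0 X0 subrr.
  rewrite (Rintegral_co_split (b := j%:R * h) Fb)//; last 3 first.
  - by rewrite mulr_ge0// ltW.
  - by rewrite ler_pM2r// ler_nat.
  - by rewrite -hT ler_pM2r// ler_nat.
  rewrite IH; last exact: ltnW.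
  rewrite (Rintegral_co_cst (k := l (h^-1 *: (X j.+1 - X j)))); last 2 first.
  - by rewrite ltr_pM2r// ltr_nat.
  - by move=> s /(grid_index_eq T0) sj; rewrite /F /= /idx sj.
  have -> : j.+1%:R * h - j%:R * h = h by rewrite -natr1; ring.
  by rewrite dual_funZ dual_funB mulrC mulrA divff ?gt_eqF// mul1r addrC addrA subrK.
have /andP[lo up] := idxb t Dt.
have /DE/andP[t0 tT] := Dt.
have i0 : 0 <= (idx t)%:R * h by rewrite mulr_ge0// ltW.
rewrite (Rintegral_co_split (b := (idx t)%:R * h) Fb)//.
rewrite node ?(leqW (idxn t))// opprD addrA subrr sub0r normrN.
rewrite (le_trans (Rintegral_co_bound Fb _ _ _ (K := 2 * M) _))//.
rewrite mulrAC ler_pM2r// ler_pM2l// lerBlDl.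
by move: up; rewrite -natr1 mulrDl mul1r.
Qed.

End ApproximateSolution.

(** * Compactness of equi-Lipschitz step functions *)

Lemma increasing_extraction (P : nat -> nat -> Prop) :
  (forall j m, exists2 n, (m <= n)%N & P j n) ->
  exists2 k : nat -> nat, {homo k : m n / (m < n)%N} & forall j, P j (k j).
Proof.
move=> Pex; pose next j m := projT1 (cid2 (Pex j m)).
have nextP j m : (m <= next j m)%N /\ P j (next j m).
  by rewrite /next; case: cid2.
pose k := fix k j := if j is i.+1 then next j (k i).+1 else next 0 0.
exists k; last by case=> [|j]; exact: (nextP _ _).2.
by apply: homo_ltn => [|j]; [exact: ltn_trans|exact: (nextP _ _).1].
Qed.

Section EquiLipschitz.
Context {R : realType} {V : normedModType R}.
Variables (T c : R) (K : set V) (h : nat -> R) (x : nat -> R -> V).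
Local Notation D := (`[0, T]%classic : set R).
Hypothesis T0 : 0 < T.
Hypothesis c0 : 0 <= c.
Hypothesis cK : compact K.
Hypothesis h0 : h @ \oo --> 0.
Hypothesis xK : forall n t, D t -> K (x n t).
Hypothesis x_lip : forall n s t, D s -> D t -> `|x n s - x n t| <= c * ( `|s - t| + h n).

(** The sequence has a cluster point v for pointwise convergence by
    Tychonoff's theorem. Closeness to v at finitely many points of a grid is
    then infinitely often achieved, and the common Lipschitz estimate spreads
    it over [0, T]. *)
Lemma uniform_subsequence : exists (k : nat -> nat) (v : R -> V),
  [/\ {homo k : m n / (m < n)%N},
      forall t, D t -> K (v t),
      forall s t, D s -> D t -> `|v s - v t| <= c * `|s - t| &
      forall e : R, 0 < e -> \forall n \near \oo, forall t, D t -> `|x (k n) t - v t| <= e].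
Proof.
(* Outside [0, T] the value at 0 is used, to stay in the compact set. *)
have D0 : D 0 by rewrite /= in_itv/= lexx ltW.
pose y n : prod_topology (fun _ : R => V) := fun t => if t \in D then x n t else x n 0.
have yE n t : D t -> y n t = x n t by move=> Dt; rewrite /y mem_set.
have yK n : [set f : R -> V | forall t, K (f t)] (y n).
  by move=> t; rewrite /y; case: ifPn => [/set_mem Dt|_]; exact: xK.
have [v [vK v_cluster]] : exists v : prod_topology (fun _ : R => V),
    (forall t, K (v t)) /\ cluster (y @ \oo) v.
  have [|v [vK vc]] := @tychonoff R (fun=> V) (fun=> K) (fun=> cK) (y @ \oo) _.
    by exists 0%N => // n _; exact: yK.
  by exists v.
(* The sequence comes back infinitely often close to v on any finite set. *)
have close (I : finType) (pt : I -> R) (e : R) m : 0 < e ->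
    exists2 n, (m <= n)%N & (h n <= e /\ forall i, D (pt i) -> `|x n (pt i) - v (pt i)| < e).
  move=> e0.
  have hF : (y @ \oo) [set f | exists n, [/\ (m <= n)%N, h n <= e & f = y n]].
    have : \forall n \near \oo, (m <= n)%N /\ h n <= e.
      near=> n; split; first by near: n; exact: nbhs_infty_ge.
      by near: n; apply: cvgr_le h0 _ e0.
    by apply: filterS => n [mn hn] /=; exists n.
  have vN : nbhs v [set f : prod_topology (fun _ : R => V) |
      forall i, `|v (pt i) - f (pt i)| < e].
    apply: (@filter_forall _ I (fun i => [set f : prod_topology (fun _ : R => V) |
      `|v (pt i) - f (pt i)| < e]) (nbhs v) (nbhs_filter v)) => i.
    have vb : nbhs (v (pt i)) [set u : V | `|v (pt i) - u| < e].
      by apply/nbhs_ballP; exists e => //= u; rewrite -ball_normE.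
    exact: (@proj_continuous R (fun=> V) (pt i) v _ vb).
  have [f [[n [mn hn ->]] fv]] := v_cluster _ _ hF vN.
  exists n => //; split => // i Di.
  by rewrite distrC -(yE n (pt i) Di); exact: fv.
have v_lip s t : D s -> D t -> `|v s - v t| <= c * `|s - t|.
  move=> Ds Dt; apply/ler_addgt0Pr => e e0.
  have c2 : 0 < c + 2 by rewrite ltr_wpDl.
  have [n _ [hn]] := close bool (fun b => if b then s else t) _ 0%N (divr_gt0 e0 c2).
  move=> xv; have xs := xv true Ds; have xt := xv false Dt.
  have -> : v s - v t = (x n s - x n t) - (x n s - v s) + (x n t - v t).
    by rewrite opprB [x n s - x n t + _]addrC !subrKA.
  rewrite (le_trans (ler_normD _ _))// (le_trans (lerD (ler_normB _ _) (lexx _)))//.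
  have := x_lip n Ds Dt; have := ler_wpM2l c0 hn.
  have : c * (e / (c + 2)) + 2 * (e / (c + 2)) = e by field; rewrite gt_eqF.
  move: xs xt; rewrite /= mulrDr; lra.
have unif (e : R) m : 0 < e -> exists2 n, (m <= n)%N & forall t, D t -> `|x n t - v t| <= e.
  move=> e0; have c3 : 0 < 3 * c + 1 by rewrite ltr_wpDl// mulr_ge0.
  set d := e / (3 * c + 1); have d0 : 0 < d by rewrite divr_gt0.
  pose q := Num.truncn (T / d).
  have qd : T / q.+1%:R <= d.
    rewrite ler_pdivrMr// -ler_pdivrMl// mulrC ltW//.
    by have /andP[] := truncn_itv (divr_ge0 (ltW T0) (ltW d0)).
  have [n mn [hn xv]] := close 'I_q.+1 (fun i => i%:R * (T / q.+1%:R)) _ m d0.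
  exists n => // t Dt; have tT : 0 <= t <= T by move: Dt; rewrite /= in_itv.
  have /andP[lo up] := grid_index_bounds q T0 tT.
  set i := grid_index T q t in lo up; set s := i%:R * _ in lo.
  have Ds : D s.
    rewrite /= in_itv/= /s mulr_ge0 ?divr_ge0 ?(ltW T0)//=.
    by case/andP: tT => _; exact: le_trans.
  have st : `|s - t| <= d.
    rewrite ler0_norm ?subr_le0// opprB lerBlDl (le_trans up)//.
    by rewrite -natr1 mulrDl mul1r lerD2l.
  have iq : (i < q.+1)%N by rewrite ltnS grid_index_le.
  have := xv (Ordinal iq) Ds; rewrite /= -/s => xs.
  have -> : x n t - v t = (x n s - v s) - (x n s - x n t) + (v s - v t).
    by rewrite opprB [x n s - v s + _]addrC !subrKA.
  rewrite (le_trans (ler_normD _ _))// (le_trans (lerD (ler_normB _ _) (lexx _)))//.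
  have := x_lip n Ds Dt; have := ler_wpM2l c0 hn; have := ler_wpM2l c0 st.
  have := v_lip s t Ds Dt.
  have : 3 * (c * d) + d = e by rewrite /d; field; rewrite gt_eqF.
  rewrite mulrDr; lra.
have [k kh kP] := increasing_extraction
  (fun j m => unif j.+1%:R^-1 m ltac:(by rewrite invr_gt0)).
exists k, v; split => // e e0.
have := @cvg_harmonic R => /cvgr_le/(_ _ e0); apply: filterS => n /= ne t Dt.
by rewrite (le_trans (kP n t Dt)).
Unshelve. all: by end_near. Qed.

End EquiLipschitz.

(** * Differentiating a weak primitive *)

Lemma countable_range (W : Type) (A : set W) (a0 : W) : countable A -> A a0 ->
  exists2 e : nat -> W, forall n, A (e n) & forall a, A a -> exists n, e n = a.
Proof.
elim/Pchoice: W => W in A a0 *.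
move=> /countable_injP[i iinj] Aa0.
pose e n := if pselect (exists2 a, A a & i a = n) is left ex then projT1 (cid2 ex) else a0.
exists e => [n|a Aa]; rewrite /e.
  by case: pselect => [ex|//]; case: (cid2 ex).
exists (i a); case: pselect => [ex|]; last by case; exists a.
by case: (cid2 ex) => b Ab iab /=; apply: iinj; rewrite ?inE.
Qed.

Lemma separable_dense_sequence (R : realType) (V : normedModType R) : separable V ->
  exists d : nat -> V, forall x (e : R), 0 < e -> exists n, `|x - d n| < e.
Proof.
move=> [A cA dA].
have ball_meets (x : V) (e : R) : 0 < e -> exists2 a, A a & `|x - a| < e.
  move=> e0; have [||a [xa Aa]] := dA (ball x e).
  - by exists x; exact: ballxx.
  - exact: ball_open.
  - by exists a => //; move: xa; rewrite -ball_normE.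
have [a0 Aa0 _] := ball_meets 0 1 ltr01.
have [d _ dP] := countable_range cA Aa0; exists d => x e /(ball_meets x)[a Aa xa].
by have [n dn] := dP a Aa; exists n; rewrite dn.
Qed.

(** For each ball centred in the dense sequence of the space, with radius
    1 / (m + 1), choose a point of C in it when there is one. *)
Lemma dense_sequence_in (R : realType) (V : normedModType R) (C : set V) (c0 : V) :
  separable V -> C c0 ->
  exists2 q : nat -> V, forall n, C (q n) &
    forall c (e : R), C c -> 0 < e -> exists n, `|c - q n| < e.
Proof.
move=> /separable_dense_sequence[d dP] Cc0.
pose P (k m : nat) c := C c /\ `|c - d k| < m.+1%:R^-1.
pose q (u : nat * nat) := if pselect (exists c, P u.1 u.2 c) is left ex
  then projT1 (cid ex) else c0.
exists (fun n => if unpickle n is Some u then q u else c0) => [n|c e Cc e0].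
  case: unpickle => // u; rewrite /q; case: pselect => // ex.
  by case: (cid ex) => ? [].
have e2 : 0 < e / 2 by rewrite divr_gt0.
have := @cvg_harmonic R => /cvgr_lt/(_ _ e2)[m _ /(_ m (leqnn m)) /= me].
have [k ck] := dP c m.+1%:R^-1 ltac:(by rewrite invr_gt0).
exists (pickle (k, m)); rewrite pickleK /q; case: pselect => [ex|]; last first.
  by case; exists c.
case: (cid ex) => c' [_ /= c'k].
rewrite -(subrKA (d k)) (le_lt_trans (ler_normD _ _))// [ltRHS]splitr.
by rewrite ltrD// ?(lt_trans ck)// distrC (lt_trans c'k).
Qed.

Section WeakDerivative.
Context {R : realType} {V : normedModType R} (T K : R) (v G : R -> V).
Local Notation mu := (@lebesgue_measure R).
Local Notation D := (`[0, T]%classic : set (measurableTypeR R)).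
Hypothesis V_smooth : uniformly_smooth V.
Hypothesis V_separable : separable V.
Hypothesis G_limit : simple_limit D G.
Hypothesis G_bounded : forall t, D t -> `|G t| <= K.
Hypothesis v_weak : forall (l : dual V) t, (forall y, `|l y| <= `|y|) -> D t ->
  l (v t) - l (v 0) = \int[mu]_(s in `[0, t[) (l (G s) : R).

Let dual_bm (l : dual V) : (forall y, `|l y| <= `|y|) ->
  bounded_measurable D (fun t => l (G t) : R).
Proof.
move=> lb; split; last by exists K => t Dt; rewrite (le_trans (lb _))// G_bounded.
apply: simple_limit_measurable; first exact: measurable_itv.
exact: (simple_limit_comp (h := (l : V -> R)) (@dual_continuous _ _ l) G_limit).
Qed.

Let dist_bm d : bounded_measurable D (fun t => `|G t - d|).
Proof.
split; last first.
  exists (K + `|d|) => t Dt; rewrite normr_id (le_trans (ler_normB _ _))//.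
  by rewrite lerD2r G_bounded.
apply: simple_limit_measurable; first exact: measurable_itv.
apply: (simple_limit_comp (h := fun u : V => `|u - d|)) G_limit.
by move=> u; apply: cvg_norm; apply: cvgB; [exact: cvg_id|exact: cvg_cst].
Qed.

(** For every test form l, l(v b - v a - (b - a) d) is the integral of
    l(G - d), at most the integral of |G - d|. *)
Lemma weak_increment_bound d a b : 0 <= a -> a <= b -> b <= T ->
  `|v b - v a - (b - a) *: d| <= \int[mu]_(s in `[a, b[) `|G s - d|.
Proof.
move=> a0 ab bT.
apply: norm_le_of_dual => // [|l lb]; first exact: Rintegral_ge0.
have Da : D a by rewrite /= in_itv/= a0 (le_trans ab).
have Db : D b by rewrite /= in_itv/= bT (le_trans a0).
have Dab : `[a, b[ `<=` D by exact: subitv_co.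
have -> : l (v b - v a - (b - a) *: d) = \int[mu]_(s in `[a, b[) (l (G s) - l d : R).
  have -> : l (v b - v a - (b - a) *: d) =
      (l (v b) - l (v 0)) - (l (v a) - l (v 0)) - (b - a) * l d.
    by rewrite !dual_funB dual_funZ; congr (_ - _); rewrite opprB addrA subrK.
  rewrite !v_weak// (Rintegral_co_split (dual_bm lb) (lexx 0) a0 ab bT).
  rewrite [X in X - _ - _]addrC addrK RintegralB//; last 2 first.
  - exact: integrable_co (dual_bm lb) a0 bT.
  - exact: (integrable_co (bounded_measurable_cst _ _) a0 bT).
  congr (_ - _); move: ab; rewrite le_eqVlt => /predU1P[->|ab].
    by rewrite subrr mul0r set_itvco0 Rintegral_set0.
  by rewrite (@Rintegral_co_cst _ (fun=> l d : R) a b (l d))// mulrC.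
apply: le_Rintegral => //.
- exact: (integrable_co (bounded_measurableB (dual_bm lb) (bounded_measurable_cst _ _)) a0 bT).
- exact: integrable_co (dist_bm d) a0 bT.
move=> s _; rewrite -dual_funB (le_trans (ler_norm _))//.
Qed.

Let f d : R -> R := (fun t => `|G t - d|) \_ D.
Let F d (x : R) : R := \int[mu]_(t in `]-oo, x]) f d t.

Let f_int d : mu.-integrable setT (EFin \o f d).
Proof.
rewrite -restrict_EFin; apply/integrable_restrict => //=; rewrite setTI.
apply: bounded_measurable_integrable => //.
exact: (@mu_itv_fin _ T _ (fun t Dt => Dt)).
Qed.

(** F d is a primitive of |G - d|; the absolute value on the right makes the
    estimate symmetric in a and b, as both one-sided quotients are needed. *)
Lemma increment_boundF d a b : D a -> D b ->
  `|v b - v a - (b - a) *: d| <= `|F d b - F d a|.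
Proof.
suff main x y : D x -> D y -> x <= y -> `|v y - v x - (y - x) *: d| <= `|F d y - F d x|.
  move=> Da Db; have [ab|/ltW ba] := lerP a b; first exact: main.
  have -> : v b - v a - (b - a) *: d = - (v a - v b - (a - b) *: d).
    by rewrite -[in LHS]scaleNr !opprB addrC.
  by rewrite normrN (distrC (F d b)); exact: main.
rewrite /= !in_itv/= => /andP[x0 xT] /andP[y0 yT] xy.
rewrite (le_trans (weak_increment_bound d x0 xy yT))// (le_trans _ (ler_norm _))//.
have fS (i : interval R) : mu.-integrable [set` i] (EFin \o f d).
  by apply: integrableS (f_int d) => //; exact: measurable_itv.
rewrite /F (Rintegral_itvB (fS _)) ?bnd_simp//.
rewrite Rintegral_itv_obnd_cbnd; last exact: fS.
rewrite -Rintegral_itv_bndo_bndc; last exact: fS.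
rewrite le_eqVlt; apply/orP; left; apply/eqP.
apply: eq_Rintegral => t /set_mem/(subitv_co x0 yT) Dt.
by rewrite /f patchE mem_set.
Qed.

(** At almost every t all the primitives F d_n have derivative
    |G t - d_n|. There the difference quotients of v are asymptotically within
    |G t - d_n| of d_n, hence within 2 |G t - d_n| of G t, which is as small
    as desired. *)
Lemma ae_derivative_of_weak :
  {ae mu, forall t, D t -> derivable v t 1 /\ 'D_1 v t = G t}.
Proof.
have [d dP] := separable_dense_sequence V_separable.
have FTC n : {ae mu, forall x, derivable (F (d n)) x 1 /\ derive1 (F (d n)) x = f (d n) x}.
  apply: FTC1Ny.
    by move=> y; apply: integrableS (f_int (d n)) => //; exact: measurable_itv.
  rewrite /f; apply: integrable_locally; first exact: measurable_itv.
  apply: (bounded_measurable_integrable _ _ (dist_bm (d n))) => //.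
  exact: (@mu_itv_fin _ T _ (fun t Dt => Dt)).
(* The endpoints are discarded: v is not controlled outside [0, T]. *)
have ends : {ae mu, forall t : R, t != 0 /\ t != T}.
  exists ([set 0] `|` [set T]); split.
  - exact: measurableU.
  - apply/eqP; rewrite -measure_le0 (le_trans (measureU2 _ _ _))//=.
    by rewrite !lebesgue_measure_set1 adde0.
  - by move=> t; apply: contra_notP => /not_orP[/eqP t0 /eqP tT].
have /ae_foralln FTC' := FTC.
move: ends FTC'; apply: filterS2; first exact: (ae_filter_ringOfSetsType mu).
move=> t [t0 tT] Ft Dt.
suff cv : (fun h : R => h^-1 *: (v (h + t) - v t)) @ 0^' --> G t.
  have E : (fun h : R => h^-1 *: ((v \o shift t) (h *: 1) - v t)) =
           (fun h : R => h^-1 *: (v (h + t) - v t)).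
    by apply/funext => h /=; rewrite [h *: 1]mulr1.
  split; first by apply/cvg_ex; exists (G t); rewrite E.
  by rewrite /derive E; exact: cvg_lim.
apply/cvgrPdist_le => e e0; have e4 : 0 < e / 4 by rewrite divr_gt0.
have [n dn] := dP (G t) _ e4.
have [Fd FE] := Ft n.
have Fcv : (fun h : R => h^-1 * (F (d n) (h + t) - F (d n) t)) @ 0^' --> `|G t - d n|.
  have -> : `|G t - d n| = 'D_1 (F (d n)) t by rewrite -derive1E FE /f patchE mem_set.
  move: Fd; rewrite /derivable /derive.
  by under eq_fun do rewrite /= [_ *: 1]mulr1.
have /andP[tpos tlt] : (0 < t) && (t < T).
  by move: Dt; rewrite /= in_itv/= => /andP[lo up]; rewrite !lt_neqAle lo up eq_sym t0 tT.
have tnbh : \forall h \near (0 : R)^', D (h + t).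
  have m0 : 0 < Num.min t (T - t) by rewrite lt_min tpos subr_gt0.
  apply/nbhs_ballP; exists (Num.min t (T - t)) => //= h.
  rewrite -ball_normE /= sub0r normrN lt_min => /andP[ht hT] _.
  move: ht hT; rewrite !ltr_norml => /andP[h1 h2] /andP[h3 h4].
  by rewrite /= in_itv/=; apply/andP; split; lra.
have hne : \forall h \near (0 : R)^', h != 0 by exact: nbhs_dnbhs_neq.
have Fn' : \forall h \near (0 : R)^', `|h^-1 * (F (d n) (h + t) - F (d n) t)| <= e / 2.
  by move/cvg_norm : Fcv => /cvgr_le; apply; rewrite normr_id; lra.
move: Fn' tnbh hne; apply: filterS3 => h Fh Dh h0.
have -> : G t - h^-1 *: (v (h + t) - v t) =
    (G t - d n) - h^-1 *: (v (h + t) - v t - (h + t - t) *: d n).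
  by rewrite addrK [in RHS]scalerBr scalerA mulVf// scale1r opprB addrA subrK.
rewrite (le_trans (ler_normB _ _))//.
have : `|h^-1 *: (v (h + t) - v t - (h + t - t) *: d n)| <= e / 2.
  rewrite normrZ (le_trans _ Fh)// normrM ler_wpM2l//.
  exact: increment_boundF.
lra.
Qed.

End WeakDerivative.

(** * Passing to the limit in the proximal inequality *)

Section BoundedIntegrals.
Context d (T : measurableType d) (R : realType) (mu : {measure set T -> \bar R}).
Variable E : set T.
Hypothesis mE : measurable E.
Hypothesis muE : (mu E < +oo)%E.

Lemma Rintegral_bounded_cvg (f_ : nat -> T -> R) (f : T -> R) (K : R) :
  (forall n, measurable_fun E (f_ n)) ->
  (forall n t, E t -> `|f_ n t| <= K) ->
  (forall t, E t -> f_ n t @[n --> \oo] --> f t) ->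
  \int[mu]_(t in E) f_ n t @[n --> \oo] --> \int[mu]_(t in E) f t.
Proof.
move=> mf fK ff.
have bf n : bounded_measurable E (f_ n) by split => //; exists K; exact: fK.
have fb : bounded_measurable E f.
  split; first exact: measurable_fun_cvg ff.
  exists K => t Et; apply: (cvgr_to_le (cvg_norm (ff t Et))).
  by apply: nearW => n; exact: fK.
apply: fine_cvg; rewrite fineK; last first.
  exact/integrable_fin_num/bounded_measurable_integrable.
apply: (@dominated_cvg _ _ _ mu _ mE (fun n t => (f_ n t)%:E) _ (EFin \o (fun=> K))) => //.
- by move=> n; exact/measurable_EFinP.
- by move=> t Et; apply/cvg_EFin; [exact: nearW|exact: ff].
- exact/bounded_measurable_integrable/bounded_measurable_cst.
Qed.

(** Integrate over the set where F is negative. *)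
Lemma ae_ge0_of_integrals (F : T -> R) : bounded_measurable E F ->
  (forall A, measurable A -> 0 <= \int[mu]_(t in E) (F t * \1_A t)) ->
  {ae mu, forall t, E t -> 0 <= F t}.
Proof.
move=> bF intF; have [mF _] := bF.
pose A := E `&` F @^-1` `]-oo, 0[.
have mA : measurable A by apply: mF => //; exact: measurable_itv.
pose H t : R := F t * \1_A t.
have bH : bounded_measurable E H.
  by apply: bounded_measurableM => //; exact: bounded_measurable_indic.
have H_le0 t : H t <= 0.
  rewrite /H indicE; case: (boolP (t \in A)) => [/set_mem[_]|_]; last by rewrite mulr0.
  by rewrite /= in_itv/= mulr1 => /ltW.
have iH := bounded_measurable_integrable mE muE bH.
have iNH : mu.-integrable E (EFin \o (fun t => -1 * H t)).
  apply: (bounded_measurable_integrable mE muE); apply: bounded_measurableM bH.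
  exact: bounded_measurable_cst.
have int0 : (\int[mu]_(t in E) `|(EFin \o H) t| = 0)%E.
  rewrite (eq_integral (EFin \o (fun t => -1 * H t))); last first.
    by move=> t _; rewrite /= ler0_norm// mulN1r.
  rewrite -(fineK (integrable_fin_num mE iNH)) -/(Rintegral _ _ _).
  apply/eqP; rewrite eqe eq_le; apply/andP; split.
    by rewrite RintegralZl// mulN1r oppr_le0; exact: intF.
  by apply: Rintegral_ge0 => t _; rewrite mulN1r oppr_ge0.
have mH : measurable_fun E (EFin \o H) by apply/measurable_EFinP; have [] := bH.
have [N [mN N0 sN]] := (ae_eq_integral_abs mu mE mH).1 int0.
exists N; split => // t; apply: contra_notP => Nt Et; rewrite leNgt; apply/negP => Ft.
have /(_ Et) : E t -> (EFin \o H) t = 0%E by apply: contrapT => H0; exact/Nt/sN.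
rewrite /= /H indicE mem_set; last by split => //=; rewrite in_itv.
by rewrite mulr1 => -[F0]; move: Ft; rewrite F0 ltxx.
Qed.

End BoundedIntegrals.

Section ProximalLimit.
Context {R : realType} {V : normedModType R}.
Variables (T p rho M K : R) (C0 : set V) (x w : nat -> R -> V) (v y : R -> V).
Local Notation mu := (@lebesgue_measure R).
Local Notation D := (`[0, T]%classic : set (measurableTypeR R)).
Hypothesis V_smooth : uniformly_smooth V.
Hypothesis V_separable : separable V.
Hypothesis p1 : 1 < p.
Hypothesis rho0 : 0 < rho.
Hypothesis C0_nonempty : C0 !=set0.
Hypothesis x_cvg : forall e : R, 0 < e ->
  \forall n \near \oo, forall t, D t -> `|x n t - v t| <= e.
Hypothesis v_limit : simple_limit D v.
Hypothesis v_bounded : forall t, D t -> `|v t| <= M.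
Hypothesis w_simple : forall n, simple_fun D (w n).
Hypothesis w_bounded : forall n t, D t -> `|w n t| <= M.
Hypothesis y_limit : simple_limit D y.
Hypothesis y_bounded : forall t, D t -> `|y t| <= K.
Hypothesis Jp_limit : forall (z : R -> V) (phi : R -> R^o),
  Linfty D z -> L1 D phi ->
  \int[mu]_(t in D)
     ((Jp p (z t + w n t) - Jp p (w n t)) (w n t) * phi t)
     @[n --> \oo] -->
  \int[mu]_(t in D) ((Jp p (z t + y t) - Jp p (y t)) (y t) * phi t).
Hypothesis x_prox : forall n t, D t -> proximal_at C0 rho (x n t) (w n t).

Let mD : measurable D. Proof. exact: measurable_itv. Qed.
Let muD : (mu D < +oo)%E. Proof. exact: (@mu_itv_fin _ T _ (fun t Dt => Dt)). Qed.

(** With z = (v - c) / rho, the proximal inequality for w n is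
    |z + w n|^p >= |w n|^p up to the error of replacing x n by v, which tends
    to 0 uniformly. Its integral over any measurable set passes to the
    limit. *)
Lemma ae_proximal_point c : C0 c ->
  {ae mu, forall t, D t -> rho * `|y t| <= `|v t + rho *: y t - c|}.
Proof.
move=> Cc; have p0 : 0 < p := lt_trans ltr01 p1.
pose z t := rho^-1 *: (v t - c).
have z_limit : simple_limit D z.
  apply: (simple_limit_comp (h := fun u : V => rho^-1 *: (u - c)) _ v_limit).
  by move=> u; apply: cvgZl_tmp; apply: cvgB; [exact: cvg_id|exact: cvg_cst].
pose M' := Num.max M (rho^-1 * (M + `|c|)).
have zM t : D t -> `|z t| <= M'.
  move=> Dt; rewrite le_max normrZ gtr0_norm ?invr_gt0// ler_pM2l ?invr_gt0//.
  by rewrite (le_trans (ler_normB _ _)) ?orbT// lerD2r v_bounded.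
have wM n t : D t -> `|w n t| <= M' by move=> Dt; rewrite le_max w_bounded.
have bm (u : R -> V) (c' : R) : simple_limit D u -> (forall t, D t -> `|u t| <= c') ->
    bounded_measurable D (fun t => `|u t| `^ p : R).
  move=> lu uc; split; first exact: (normp_measurable V_smooth p1 mD lu).
  exists (c' `^ p) => t Dt; rewrite ger0_norm ?powR_ge0//.
  by rewrite ge0_ler_powR ?nnegrE ?uc ?(ltW p0)// (le_trans _ (uc t Dt)).
have bmF (u : R -> V) (c' : R) : simple_limit D u -> (forall t, D t -> `|u t| <= c') ->
    bounded_measurable D (fun t => `|z t + u t| `^ p - `|u t| `^ p : R).
  move=> lu uc; apply: bounded_measurableB; last exact: bm uc.
  apply: (bm _ (M' + c')); first exact: simple_limitD.
  by move=> t Dt; rewrite (le_trans (ler_normD _ _))// lerD ?zM ?uc.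
have bw n : bounded_measurable D (fun t => `|z t + w n t| `^ p - `|w n t| `^ p : R).
  by apply: (bmF _ M'); [exact: simple_limit_simple|exact: wM].
have ge0 : {ae mu, forall t, D t -> 0 <= `|z t + y t| `^ p - `|y t| `^ p}.
  apply: ae_ge0_of_integrals => //; first exact: bmF y_bounded.
  move=> A mA.
  have lim := normp_weak_limit V_smooth p1 mD muD mA w_simple wM y_limit y_bounded
    z_limit zM Jp_limit.
  apply/ler_addgt0Pr => e e0; rewrite -lerBlDr sub0r.
  apply: (cvgr_to_ge lim).
  (* c1 is a Lipschitz constant of the norm power on a ball containing z t + w n t
     and its perturbation, divided by rho; the summand 1 makes it positive, and
     del is at most rho, so that the perturbation is at most 1, and small enough
     for the error to integrate to at most e. *)
  pose c1 := (2 * M' + 1 + 1) `^ p / rho + 1.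
  have c10 : 0 < c1 by rewrite ltr_wpDl// divr_ge0 ?powR_ge0 ?ltW.
  pose m := fine (mu D).
  have m0 : 0 <= m by rewrite fine_ge0.
  pose del := Num.min rho (e / (c1 * (m + 1))).
  have del0 : 0 < del by rewrite lt_min rho0 divr_gt0// mulr_gt0// ltr_wpDl.
  have := x_cvg del0; apply: filterS => n xn.
  have low t : D t -> - (c1 * del) <= (`|z t + w n t| `^ p - `|w n t| `^ p).
    move=> Dt; pose z' := rho^-1 *: (x n t - c).
    have zz' : `|z t - z'| <= del / rho.
      rewrite /z /z' -scalerBr normrZ gtr0_norm ?invr_gt0// mulrC ler_pM2r ?invr_gt0//.
      by rewrite opprB addrA addrNK distrC xn.
    have prox : `|w n t| <= `|z' + w n t|.
      have := x_prox n Dt Cc.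
      have -> : x n t + rho *: w n t - c = rho *: (z' + w n t).
        by rewrite scalerDr scalerA divff ?gt_eqF// scale1r addrAC.
      by rewrite normrZ gtr0_norm// ler_pM2l.
    have zw : `|z t + w n t| <= 2 * M' + 1.
      rewrite (le_trans (ler_normD _ _))//.
      by have := zM t Dt; have := wM n t Dt; lra.
    have zw' : `|z' + w n t| <= 2 * M' + 1.
      have -> : z' + w n t = z t + w n t - (z t - z') by rewrite opprB [RHS]addrC addrA subrK.
      rewrite (le_trans (ler_normB _ _))// (le_trans (lerD (ler_normD _ _) zz'))//.
      have : del / rho <= 1 by rewrite ler_pdivrMr// mul1r ge_min lexx.
      by have := zM t Dt; have := wM n t Dt; lra.
    have := normp_lipschitz p1 zw zw'.
    rewrite opprD addrACA subrr addr0 => lip.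
    have : `|w n t| `^ p <= `|z' + w n t| `^ p.
      by rewrite ge0_ler_powR ?nnegrE ?(ltW p0).
    have : (2 * M' + 1 + 1) `^ p * `|z t - z'| <= c1 * del.
      have -> : c1 * del = (2 * M' + 1 + 1) `^ p * (del / rho) + del by rewrite /c1; ring.
      rewrite (le_trans (ler_wpM2l _ zz')) ?powR_ge0//.
      by rewrite lerDl ltW.
    move: lip; rewrite ler_norml => /andP[+ _].
    by move: (_ * `|z t - z'|) (`|z t + _| `^ p) (`|z' + _| `^ p) => *; lra.
  have bA : bounded_measurable D (\1_A : R -> R) by exact: bounded_measurable_indic.
  rewrite (@le_trans _ _ (\int[mu]_(t in D) (- (c1 * del))))//.
    rewrite Rintegral_cst// -/m mulNr lerN2.
    have : del <= e / (c1 * (m + 1)) by rewrite ge_min lexx orbT.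
    rewrite ler_pdivlMr ?mulr_gt0// ?ltr_wpDl// => /(le_trans _); apply.
    by rewrite mulrA (mulrC del) ler_wpM2l ?lerDl// mulr_ge0 ?ltW.
  apply: le_Rintegral => //.
  - exact/bounded_measurable_integrable/bounded_measurable_cst.
  - exact/bounded_measurable_integrable/bounded_measurableM.
  move=> t Dt; rewrite indicE; case: (t \in A); first by rewrite mulr1 low.
  by rewrite mulr0 oppr_le0 mulr_ge0 ?ltW.
move: ge0; apply: filterS.
move=> t /= H Dt; have := H Dt; rewrite subr_ge0 => zy.
have {}zy : `|y t| <= `|z t + y t|.
  rewrite leNgt; apply/negP => lt; move: zy; rewrite leNgt => /negP; apply.
  by rewrite gt0_ltr_powR ?nnegrE.
have -> : v t + rho *: y t - c = rho *: (z t + y t).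
  by rewrite scalerDr scalerA divff ?gt_eqF// scale1r addrAC.
by rewrite normrZ gtr0_norm// ler_pM2l.
Qed.

(** A countable dense family of points c gives one common null set. *)
Lemma ae_proximal_limit : {ae mu, forall t, D t -> proximal_at C0 rho (v t) (y t)}.
Proof.
have [c0 Cc0] := C0_nonempty.
have [q qC qd] := dense_sequence_in V_separable Cc0.
have /ae_foralln : forall n, {ae mu, forall t, D t ->
    rho * `|y t| <= `|v t + rho *: y t - q n|}.
  by move=> n; exact: ae_proximal_point.
apply: filterS.
move=> t H Dt c Cc; apply/ler_addgt0Pr => e e0.
have [n cn] := qd c e Cc e0.
rewrite (le_trans (H n Dt))//.
rewrite -(subrKA c) (le_trans (ler_normD _ _))// lerD2l ltW//.
Qed.

End ProximalLimit.

(** * Existence of a solution *)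

Lemma increasing_cvg_infty (k : nat -> nat) : {homo k : m n / (m < n)%N} -> k @ \oo --> \oo.
Proof.
move=> kh; have kn n : (n <= k n)%N.
  by elim: n => // n IH; rewrite (leq_ltn_trans IH)// kh.
by move=> A [N _ NA]; exists N => // n /= Nn; apply: NA => /=; rewrite (leq_trans Nn).
Qed.

Section Sweeping.
Context {R : realType} {V : normedModType R} (C0 : set V) (g : R -> V -> V).
Variables (T p r L' : R) (u0 : V).
Local Notation mu := (@lebesgue_measure R).
Local Notation D := (`[0, T]%classic : set (measurableTypeR R)).
Local Notation M := (velocity_bound T L' u0).
Hypothesis T0 : 0 < T.
Hypothesis L'0 : 0 < L'.
Hypothesis r0 : 0 < r.
Hypothesis p1 : 1 < p.
Hypothesis V_smooth : uniformly_smooth V.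
Hypothesis V_separable : separable V.
Hypothesis V_swc : smoothly_weakly_compact D V p.
Hypothesis C0_compact : ball_compact C0.
Hypothesis g_prox : forall t, 0 <= t <= T -> prox_regular r (g t) C0.
Hypothesis g_growth : forall t x, 0 <= t <= T -> `|g t x| <= L' * (1 + `|x|).
Hypothesis g_continuous : forall (s : nat -> R) (x : nat -> V) t y,
  s @ \oo --> t -> x @ \oo --> y -> g (s n) (x n) @[n --> \oo] --> g t y.
Hypothesis C0u0 : C0 u0.

Let M0 : 0 < M. Proof. exact: velocity_bound_gt0. Qed.
Let mD : measurable D. Proof. exact: measurable_itv. Qed.
Let muD : (mu D < +oo)%E. Proof. exact: (@mu_itv_fin _ T _ (fun t Dt => Dt)). Qed.
Let D0 : D 0. Proof. by rewrite /= in_itv/= lexx ltW. Qed.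

Let rho := r / M.
Let rho0 : 0 < rho. Proof. exact: divr_gt0. Qed.

Local Notation approx := (@approximate_solution R V C0 g T L' u0 rho).

(** The mesh must satisfy h M < r, so the first values of the mesh are
    skipped. *)
Lemma approximate_sequence : exists (h : nat -> R) (x x' w v : nat -> R -> V),
  [/\ h @ \oo --> 0, forall n, 0 <= h n <= T &
      forall n, approx (h n) (x n) (x' n) (w n) (v n)].
Proof.
have := @cvg_harmonic R => /cvgr_lt/(_ (r / (T * M))).
rewrite divr_gt0 ?(mulr_gt0 T0 M0)// => /(_ isT)[N _ HN].
pose h n := T / (n + N).+1%:R.
have hM n : h n * M < r.
  have := HN (n + N)%N (leq_addl _ _); rewrite /harmonic /= => H.
  by move: H; rewrite ltr_pdivlMr ?(mulr_gt0 T0 M0)// /h mulrA (mulrC T).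
have rM : rho * M <= r by rewrite divfK// gt_eqF.
have := fun n => approximate_solution_exists T0 L'0 g_prox g_growth C0u0 (hM n) (ltW rho0) rM.
move=> /choice[x] /choice[x'] /choice[w] /choice[v] H.
exists h, x, x', w, v; split => //.
  rewrite -(mulr0 T); apply: cvgMl_tmp.
  by have := @cvg_harmonic R; rewrite -(cvg_shiftn N).
move=> n; rewrite divr_ge0 ?(ltW T0)//= ler_pdivrMr// ler_peMr ?(ltW T0)//.
by rewrite ler1n.
Qed.

(** The velocity of the limit is g(t, v) - y, and the weak limit y of the
    normal velocities is a proximal normal; together they give the
    inclusion. *)
Lemma moving_frame_solution : exists (v : R -> V) (c : R),
  [/\ 0 <= c, forall s t : R, D s -> D t -> `|v s - v t| <= c * `|s - t|,
      v 0 = u0, forall t : R, D t -> C0 (v t) &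
      {ae mu, forall t : R, D t -> derivable v t 1 /\
        exists2 w : V, normal_cone C0 (v t) w & 'D_1 v t + w = g t (v t)}].
Proof.
have [h [x [x' [w [gx [h_cvg hT app]]]]]] := approximate_sequence.
have M2 : 0 < 2 * M := mulr_gt0 (ltr0n R 2) M0.
have c0 : 0 <= 2 * M := ltW M2.
(* By as_lip the distance to u0 is at most 2 M (T + h), and h <= T. *)
pose K := closed_ball u0 (4 * M * T) `&` C0.
have b0 : 0 < 4 * M * T by rewrite mulr_gt0// mulr_gt0.
have xK n t : D t -> K (x n t).
  move=> Dt; split; last exact: (as_mem (app n)).
  rewrite closed_ballE// /closed_ball_/= -[X in `|X - _|](as_start (app n)).
  rewrite (le_trans (as_lip (app n) D0 Dt))//.
  have -> : 4 * M * T = 2 * M * (T + T) by ring.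
  rewrite ler_wpM2l// lerD//; last by have /andP[] := hT n.
  by move: Dt; rewrite /= in_itv/= => /andP[t0 tT]; rewrite sub0r normrN ger0_norm.
have cK : compact K by exact: C0_compact.
have [k1 [v [k1h vK v_lip x_unif1]]] := uniform_subsequence T0 c0
  cK h_cvg xK (fun n s t Ds Dt => as_lip (app n) Ds Dt).
have w_meas n : strongly_measurable D (w (k1 n)).
  by have [] := simple_L1 mD muD (as_w (app (k1 n))) (as_w_le (app (k1 n))).
have w_bd : exists M', forall n, ae_bounded D M' (w (k1 n)).
  by exists M => n; apply: aeW => t Dt; exact: (as_w_le (app (k1 n)) Dt).
have [k2 [y0 [k2h y0L psi_lim0 Jp_lim0]]] := V_swc w_meas w_bd.
pose k n := k1 (k2 n).
have k_oo : k @ \oo --> \oo.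
  by apply: increasing_cvg_infty => m n mn; apply/k1h/k2h.
have hk : h (k n) @[n --> \oo] --> 0 := cvg_comp _ _ k_oo h_cvg.
have x_unif (e : R) : 0 < e -> \forall n \near \oo, forall t, D t -> `|x (k n) t - v t| <= e.
  by move=> /x_unif1 H; exact: (increasing_cvg_infty k2h H).
have [N [y [Ky [mN muN y0y y_limit y_bounded]]]] := Linfty_representative mD y0L.
have psi_lim (psi : R -> dual V) : L1 D psi ->
    \int[mu]_(t in D) (psi t (w (k n) t) : R) @[n --> \oo] -->
    \int[mu]_(t in D) (psi t (y t) : R).
  move=> /psi_lim0.
  rewrite (Rintegral_representative (f' := fun t => psi t (y t)) mN muN)//.
  by move=> t /y0y ->.
have Jp_lim (z : R -> V) (phi : R -> R^o) : Linfty D z -> L1 D phi ->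
    \int[mu]_(t in D) ((Jp p (z t + w (k n) t) - Jp p (w (k n) t)) (w (k n) t) * phi t)
      @[n --> \oo] -->
    \int[mu]_(t in D) ((Jp p (z t + y t) - Jp p (y t)) (y t) * phi t).
  move=> zL phiL; have := Jp_lim0 z phi zL phiL.
  rewrite (Rintegral_representative
    (f' := fun t => (Jp p (z t + y t) - Jp p (y t)) (y t) * phi t) mN muN)//.
  by move=> t /y0y ->.
have x_cvg t : D t -> x (k n) t @[n --> \oo] --> v t.
  move=> Dt; apply/cvgrPdist_le => e e0; have := x_unif e e0.
  by apply: filterS => n /(_ t Dt); rewrite distrC.
have v0 : v 0 = u0.
  have := x_cvg 0 D0; under eq_fun do rewrite (as_start (app _)).
  by move=> /(cvg_unique _)/(_ (cvg_cst _)) ->.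
have v_limit : simple_limit D v.
  by exists (fun n => x (k n)); split => // n; exact: as_x (app _).
have vM t : D t -> `|v t| <= `|u0| + 2 * M * T.
  move=> Dt; rewrite -[v t](subrK u0) (le_trans (ler_normD _ _))// addrC lerD2l.
  rewrite -[X in `|_ - X|]v0 (le_trans (v_lip _ _ Dt D0))// ler_wpM2l// subr0.
  by move: Dt; rewrite /= in_itv/= => /andP[t0 tT]; rewrite ger0_norm.
have gx_cvg t : D t -> gx (k n) t @[n --> \oo] --> g t (v t).
  move=> Dt.
  have /choice[s sP] : forall n, exists s : R,
      `|s - t| <= h (k n) /\ gx (k n) t = g s (x (k n) t).
    by move=> n; have [s _ sP] := as_field (app (k n)) Dt; exists s.
  have s_cvg : s @ \oo --> t.
    apply/cvgrPdist_le => e e0; have /cvgr_le/(_ _ e0) := hk; apply: filterS => n hn.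
    by rewrite distrC (le_trans _ hn)//; exact: (sP n).1.
  have := g_continuous s_cvg (x_cvg t Dt).
  by rewrite (_ : (fun n => g (s n) (x (k n) t)) = (fun n => gx (k n) t))//;
    apply/funext => n; rewrite (sP n).2.
have gv_limit : simple_limit D (fun t => g t (v t)).
  by exists (fun n => gx (k n)); split => // n; exact: as_v (app _).
have gvM t : D t -> `|g t (v t)| <= M.
  move=> Dt; apply: (cvgr_to_le (cvg_norm (gx_cvg t Dt))).
  by apply: nearW => n; exact: (as_v_le (app _)).
pose G t := g t (v t) - y t.
have G_limit : simple_limit D G.
  apply: (simple_limit_comp (h := fun u : V * V => u.1 - u.2) _
    (simple_limit_pair gv_limit y_limit)).
  by move=> u; apply: cvgB; [exact: cvg_fst|exact: cvg_snd].
have G_bounded t : D t -> `|G t| <= M + Ky.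
  by move=> Dt; rewrite (le_trans (ler_normB _ _))// lerD ?gvM ?y_bounded.
have bm_l (l : dual V) (z : R -> V) (c : R) : (forall u, `|l u| <= `|u|) -> simple_limit D z ->
    (forall t, D t -> `|z t| <= c) -> bounded_measurable D (fun t => l (z t) : R).
  move=> lb zl zc; split; last by exists c => t Dt; rewrite (le_trans (lb _))// zc.
  apply: simple_limit_measurable => //.
  exact: (simple_limit_comp (h := (l : V -> R)) (@dual_continuous _ _ l) zl).
have weak (l : dual V) t : (forall u, `|l u| <= `|u|) -> D t ->
    l (v t) - l (v 0) = \int[mu]_(s in `[0, t[) (l (G s) : R).
  move=> lb Dt; have /andP[t0 tT] : 0 <= t <= T by move: Dt; rewrite /= in_itv.
  have sub : `[0, t[ `<=` D by exact: subitv_co.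
  have l_cvg (z : nat -> V) u : z @ \oo --> u -> l (z n) @[n --> \oo] --> l u.
    by move=> zu; exact: cvg_comp zu (@dual_continuous _ _ l u).
  have I_cvg : \int[mu]_(s in `[0, t[) (l (gx (k n) s) : R) @[n --> \oo] -->
      \int[mu]_(s in `[0, t[) (l (g s (v s)) : R).
    have mI : measurable (`[0, t[%classic : set (measurableTypeR R)) by exact: measurable_itv.
    apply: (@Rintegral_bounded_cvg _ _ _ mu _ mI (mu_itv_fin sub)
      (fun n s => l (gx (k n) s)) (fun s => l (g s (v s))) M).
    - move=> n; have [mf _] := bm_l l _ _ lb
        (simple_limit_simple (as_v (app (k n)))) (as_v_le (app (k n))).
      exact: measurable_funS mf.
    - by move=> n s /sub Ds; rewrite (le_trans (lb _))//; exact: (as_v_le (app _)).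
    - by move=> s /sub Ds; apply: l_cvg; exact: gx_cvg.
  (* The test function of L^1 with values in the dual is l on [0, t[. *)
  pose psi s : dual V := if s \in `[0, t[%classic then l else 0.
  have psiL : L1 D psi.
    apply: (@simple_L1 _ _ _ _ `|l|) => //.
      apply: simple_fun_if; [exact: measurable_itv|exact: simple_fun_cst|exact: simple_fun_cst].
    by move=> s _; rewrite /psi; case: ifP => // _; rewrite normr0.
  have psiE z : \int[mu]_(s in D) (psi s (z s) : R) = \int[mu]_(s in `[0, t[) (l (z s) : R).
    rewrite -[in RHS](setIidr sub) Rintegral_mkcondr; apply: eq_Rintegral => s _.
    by rewrite patchE /psi; case: ifP.
  have J_cvg : \int[mu]_(s in `[0, t[) (l (w (k n) s) : R) @[n --> \oo] -->
      \int[mu]_(s in `[0, t[) (l (y s) : R).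
    by have := psi_lim psi psiL; rewrite psiE; under eq_fun do rewrite psiE.
  have int_co z c : simple_limit D z -> (forall t, D t -> `|z t| <= c) ->
      mu.-integrable `[0, t[ (EFin \o (fun s => l (z s) : R)).
    by move=> zl zc; exact: integrable_co (bm_l l z c lb zl zc) (lexx 0) tT.
  have splitE z1 z2 c1 c2 : simple_limit D z1 -> (forall t, D t -> `|z1 t| <= c1) ->
      simple_limit D z2 -> (forall t, D t -> `|z2 t| <= c2) ->
      \int[mu]_(s in `[0, t[) (l (z1 s) - l (z2 s) : R) =
      \int[mu]_(s in `[0, t[) (l (z1 s) : R) - \int[mu]_(s in `[0, t[) (l (z2 s) : R).
    move=> zl1 zc1 zl2 zc2; rewrite RintegralB//; [exact: int_co zc1|exact: int_co zc2].
  have -> : \int[mu]_(s in `[0, t[) (l (G s) : R) =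
      \int[mu]_(s in `[0, t[) (l (g s (v s)) : R) - \int[mu]_(s in `[0, t[) (l (y s) : R).
    rewrite -(splitE _ _ _ _ gv_limit gvM y_limit y_bounded).
    by apply: eq_Rintegral => s _; rewrite dual_funB.
  pose q n : R := l (x (k n) t) - l u0 - (\int[mu]_(s in `[0, t[) (l (gx (k n) s) : R) -
    \int[mu]_(s in `[0, t[) (l (w (k n) s) : R)).
  have q_cvg : q @ \oo --> l (v t) - l u0 - (\int[mu]_(s in `[0, t[) (l (g s (v s)) : R) -
    \int[mu]_(s in `[0, t[) (l (y s) : R)).
    apply: cvgB; last exact: cvgB.
    by apply: cvgB; [exact/l_cvg/x_cvg|exact: cvg_cst].
  have q0 : q @ \oo --> 0.
    apply/cvgrPdist_le => e e0.
    have e2 : 0 < e / (2 * M) := divr_gt0 e0 M2.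
    have /cvgr_le/(_ _ e2) := hk; apply: filterS => n; rewrite (ler_pdivlMr _ _ M2) => hn.
    rewrite sub0r normrN (le_trans _ hn)// mulrCA mulrA /q.
    have := as_weak (app (k n)) lb Dt.
    by rewrite (splitE _ _ _ _
      (simple_limit_simple (as_v (app (k n)))) (as_v_le (app (k n)))
      (simple_limit_simple (as_w (app (k n)))) (as_w_le (app (k n)))).
  apply/eqP; rewrite -subr_eq0 v0; apply/eqP; exact: cvg_unique q_cvg q0.
exists v, (2 * M); split => //; first by move=> t /vK[].
have der := ae_derivative_of_weak V_smooth V_separable G_limit G_bounded weak.
pose M' := Num.max M ( `|u0| + 2 * M * T).
have x'_cvg (e : R) : 0 < e -> \forall n \near \oo, forall t, D t -> `|x' (k n) t - v t| <= e.
  move=> e0; have e2 : 0 < e / 2 by rewrite divr_gt0.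
  have e3 : 0 < e / 2 / (2 * M) := divr_gt0 e2 M2.
  have := x_unif _ e2; have /cvgr_le/(_ _ e3) := hk; apply: filterS2 => n hn xn t Dt.
  rewrite -(subrKA (x (k n) t)) (le_trans (ler_normD _ _))// [leRHS]splitr lerD ?xn//.
  rewrite (le_trans (as_next (app (k n)) Dt))//.
  by move: hn; rewrite (ler_pdivlMr _ _ M2) mulrCA mulrA.
have prox : {ae mu, forall t, D t -> proximal_at C0 rho (v t) (y t)}.
  apply: (ae_proximal_limit V_smooth V_separable p1 rho0 (ex_intro _ u0 C0u0) x'_cvg v_limit
    (M := M') _ _ _ y_limit y_bounded Jp_lim).
  - by move=> t Dt; rewrite le_max vM ?orbT.
  - by move=> n; exact: as_w (app _).
  - by move=> n t Dt; rewrite le_max (as_w_le (app _) Dt).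
  - by move=> n t Dt; exact: as_prox (app _) _ Dt.
move: der prox; apply: filterS2.
move=> t der prox Dt; have [dv vE] := der Dt; split => //; exists (y t).
  by apply: (proximal_normal_cone rho0 _ (prox Dt)); case: (vK t Dt).
by rewrite vE /G subrK.
Qed.

End Sweeping.

Lemma lipschitz_absolutely_continuous (R : realType) (V : normedModType R)
    (a b c : R) (u : R -> V) : 0 <= c ->
  (forall s t, s \in `[a, b] -> t \in `[a, b] -> `|u s - u t| <= c * `|s - t|) ->
  absolutely_continuous a b u.
Proof.
move=> c0 ulip e e0; have c1 : 0 < c + 1 by rewrite ltr_wpDl.
exists (e / (c + 1)); first exact: divr_gt0.
move=> n s t st _ len.
have le_sum : \sum_(i < n) `|u (t i) - u (s i)| <= c * \sum_(i < n) (t i - s i).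
  rewrite mulr_sumr; apply: ler_sum => i _; have [as_ [si ti]] := st i.
  rewrite (le_trans (ulip _ _ _ _))//; last by rewrite ger0_norm ?subr_ge0.
    by rewrite in_itv/= ti (le_trans as_).
  by rewrite in_itv/= as_ (le_trans si).
rewrite (le_lt_trans le_sum)//.
have sum0 : 0 <= \sum_(i < n) (t i - s i).
  by apply: sumr_ge0 => i _; have [_ [si _]] := st i; rewrite subr_ge0.
move: len; rewrite ltr_pdivlMr//; lra.
Qed.

Lemma derivative_shift (R : realType) (V : normedModType R) (v : R -> V) (a : V) (t : R) :
  derivable v t 1 ->
  derivable (fun t => v t + t *: a) t 1 /\ 'D_1 (fun t => v t + t *: a) t = 'D_1 v t + a.
Proof.
move=> dv; pose m (t : R) : V := t *: a.
have E : (fun h : R => h^-1 *: ((m \o shift t) (h *: 1) - m t)) @ 0^' --> a.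
  apply/cvgrPdist_le => e e0.
  have : \forall h \near (0 : R)^', h != 0 by exact: nbhs_dnbhs_neq.
  apply: filterS => h h0; rewrite /= /m [h *: 1]mulr1 scalerDl addrK scalerA.
  by rewrite mulVf// scale1r subrr normr0 ltW.
have dm : derivable m t 1 by apply/cvg_ex; exists a.
have mE : 'D_1 m t = a by exact: cvg_lim E.
have -> : (fun t => v t + t *: a) = v + m by [].
by split; [exact: derivableD|rewrite deriveD// mE].
Qed.

Lemma normal_cone_shift (R : realType) (V : normedModType R) (C : set V) (x b w : V) :
  normal_cone C x w -> normal_cone [set y + b | y in C] (x + b) w.
Proof.
have distE y : dist (y + b) [set c + b | c in C] = dist y C.
  rewrite /dist image_comp; congr inf; apply: eq_imagel => c _ /=.
  by rewrite opprD addrACA subrr addr0.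
move=> [s s0 [Cx xE]]; exists s => //; split; first by exists x.
by rewrite (addrAC x b) distE opprD addrACA subrr addr0.
Qed.

Theorem theorem6p9 (R : realType) (B : completeNormedModType R)
  (T p r L : R) (f : B -> B) (a : B) (C0 : set B)
  (T_gt0 : 0 < T)
  (B_separable : separable B)
  (B_reflexive : reflexive_space B)
  (B_smooth : uniformly_smooth B)
  (p_ge2 : 2 <= p)
  (B_swc : smoothly_weakly_compact `[0, T] B p)
  (r_gt0 : 0 < r)
  (f_continuous : continuous f)
  (L_gt0 : 0 < L)
  (f_growth : forall x : B, `|f x| <= L * (1 + `|x|))
  (C0_nonempty : C0 !=set0)
  (C0_ball_compact : ball_compact C0)
  (C0_prox_regular : forall t : R, t \in `[0, T] ->
    prox_regular r (fun x => f (x + t *: a) - a) C0) :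
  let C := fun t : R => [set x + t *: a | x in C0] in
  forall u0 : B, C0 u0 ->
  exists u : R -> B,
    sweeping_solution T C f u0 u /\
    forall t : R, t \in `[0, T] -> C t (u t).
Proof.
move=> C u0 C0u0.
pose g (t : R) (x : B) := f (x + t *: a) - a.
pose L' := L * (1 + T * `|a|) + `|a|.
have Ta : 0 <= T * `|a| by rewrite mulr_ge0// ltW.
have L'0 : 0 < L'.
  by rewrite ltr_wpDr// mulr_gt0// ltr_wpDr.
have g_growth t x : 0 <= t <= T -> `|g t x| <= L' * (1 + `|x|).
  move=> /andP[t0 tT]; rewrite (le_trans (ler_normB _ _))//.
  rewrite (le_trans (lerD (f_growth _) (lexx _)))//.
  have : `|x + t *: a| <= `|x| + T * `|a|.
    by rewrite (le_trans (ler_normD _ _))// lerD2l normrZ ger0_norm// ler_wpM2r.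
  rewrite -(ler_pM2l L_gt0) => xt.
  rewrite (@le_trans _ _ (L * (1 + ( `|x| + T * `|a|)) + `|a|))//.
    by rewrite lerD2r ler_pM2l// lerD2l -(ler_pM2l L_gt0).
  have nx := normr_ge0 x; have na := normr_ge0 a.
  have := mulr_ge0 nx na; have := mulr_ge0 Ta nx => Tax; rewrite -(pmulr_rge0 _ L_gt0) in Tax.
  rewrite /L'; move: Tax; lra.
have g_cont (s : nat -> R) (x : nat -> B) t y :
    s @ \oo --> t -> x @ \oo --> y -> g (s n) (x n) @[n --> \oo] --> g t y.
  move=> st xy; apply: cvgB; last exact: cvg_cst.
  have : x n + s n *: a @[n --> \oo] --> y + t *: a.
    by apply: cvgD => //; exact: cvgZr_tmp.
  by move=> H; exact: cvg_comp H (f_continuous (y + t *: a)).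
have g_prox t : 0 <= t <= T -> prox_regular r (g t) C0.
  by move=> tT; apply: C0_prox_regular; rewrite in_itv.
have p1 : 1 < p by rewrite (lt_le_trans _ p_ge2)// ltr1n.
have [v [c [c0 v_lip v0 vC ae]]] := moving_frame_solution T_gt0 L'0 r_gt0 p1
  B_smooth B_separable B_swc C0_ball_compact g_prox g_growth g_cont C0u0.
exists (fun t => v t + t *: a); split; last first.
  by move=> t tT; exists (v t) => //; exact: vC.
split; last 2 first.
- by rewrite scale0r addr0 v0.
- move: ae; apply: filterS; first exact: (ae_filter_ringOfSetsType (@lebesgue_measure R)).
  move=> t H Dt; have [dv [w Nw vw]] := H Dt.
  have [du uE] := derivative_shift a dv; split => //.
  exists w; last by rewrite uE addrAC vw /g subrK.
  exact: normal_cone_shift.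
apply: (lipschitz_absolutely_continuous (c := c + `|a|)); first exact: addr_ge0.
move=> s t sD tD; rewrite opprD addrACA -scalerBl (le_trans (ler_normD _ _))//.
by rewrite mulrDl lerD ?v_lip// normrZ mulrC.
Qed.
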